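(* There are absolute constants $c,C>0$ such that the following holds. Let $n\ge1$, $\sigma\ge0$, and let $(X_1,\dots,X_n)$ be a random vector in $\mathbf{R}^n$ whose distribution $\mu$ satisfies $\mathrm{LSI}(\sigma^2)$. Assume that $F$ has a density bounded by a number $M$, and put $\beta=\frac{(M\sigma)^{2/3}}{n^{1/3}}$. Then for any $r>0$, $$\mathbf{P}\{\|F_n-F\|\ge r\}\le\frac4r\,e^{-c(r/\beta)^3}.$$ In particular, $$\mathbf{E}\|F_n-F\|\le C\beta\log^{1/3}\left(1+\frac1\beta\right).$$
   Context: For a random vector $(X_1,\dots,X_n)$ in $\mathbf{R}^n$ with distribution $\mu$, the empirical distribution function is $F_n(x)=\frac1n\,\mathrm{card}\{i\le n: X_i\le x\}$ and $F(x)=\mathbf{E}F_n(x)=\frac1n\sum_{i=1}^n\mathbf{P}\{X_i\le x\}$, $x\in\mathbf{R}$. $\|F_n-F\|=\sup_{x\in\mathbf{R}}|F_n(x)-F(x)|$ is the Kolmogorov distance. A probability measure $\mu$ on $\mathbf{R}^n$ satisfies $\mathrm{LSI}(\sigma^2)$ (logarithmic Sobolev inequality with constant $\sigma^2$) if for every bounded smooth function $g$ on $\mathbf{R}^n$, $\mathrm{Ent}_\mu(g^2)\le2\sigma^2\int|\nabla g|^2\,d\mu$, where $\mathrm{Ent}_\mu(h)=\int h\log h\,d\mu-\int h\,d\mu\,\log\int h\,d\mu$ for $h\ge0$. (Existence of a density for $F$ forces $\sigma>0$, so $\beta>0$.) *)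

(* Defs.v *)
From HB Require Import structures.
From mathcomp Require Import all_boot all_order all_algebra.
From mathcomp Require Import all_classical all_reals all_analysis.

Set Implicit Arguments.
Unset Strict Implicit.
Unset Printing Implicit Defensive.

Import Order.TTheory GRing.Theory Num.Theory.
Import numFieldNormedType.Exports.

Local Open Scope classical_set_scope.
Local Open Scope ring_scope.

(* R^n as row vectors, with its Borel sigma-algebra.  The topology on
   'rV[R]_n is the product one; the carrier is convertible to 'rV[R]_n. *)
Notation euclid R n := (g_sigma_algebraType (@open 'rV[R]_n)).

Section Smooth.
Context {R : realType} {n : nat}.
Implicit Types (g : 'rV[R]_n -> R) (i : 'I_n).

Definition partial i g : 'rV[R]_n -> R :=
  fun x => 'D_(delta_mx 0 i) g x.

(* Class C^k: all iterated partial derivatives of order at most k exist and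
   are continuous. *)
Fixpoint class_C (k : nat) g : Prop :=
  continuous g /\
  match k with
  | 0 => True
  | k'.+1 => forall i,
      (forall x, derivable g x (delta_mx 0 i)) /\ class_C k' (partial i g)
  end.

Definition smooth g : Prop := forall k, class_C k g.

(* Squared Euclidean length of the gradient (the library norm on 'rV[R]_n is
   the sup norm, so it is not used here). *)
Definition grad_sq g (x : 'rV[R]_n) : R := \sum_(i < n) partial i g x ^+ 2.

End Smooth.

Section LogSobolev.
Context {R : realType} {n : nat}.

(* Meant for h >= 0 integrable; since ln 0 = 0, h * ln h vanishes where h does. *)
Definition Ent (mu : probability (euclid R n) R) (h : 'rV[R]_n -> R) : \bar R :=
  let m := \int[mu]_x h x in
  (\int[mu]_x (h x * ln (h x))%:E - (m * ln m)%:E)%E.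

(* The integral on the right is allowed to be +oo. *)
Definition LSI (mu : probability (euclid R n) R) (s : R) : Prop :=
  forall g : 'rV[R]_n -> R,
    (exists K : R, forall x, `|g x| <= K) -> smooth g ->
    (Ent mu (fun x => (g x ^+ 2)%R)
       <= (2 * s)%:E * \int[mu]_x (grad_sq g x)%:E)%E.

End LogSobolev.

Section EmpiricalDistribution.
Context {R : realType} {n : nat}.

Definition empirical_df (x : 'rV[R]_n) (t : R) : R :=
  #|[set i : 'I_n | x 0 i <= t]%SET|%:R / n%:R.

Definition mean_df d (T : measurableType d) (P : probability T R)
    (X : {RV P >-> euclid R n}) (t : R) : R :=
  fine 'E_P[fun w => empirical_df (X w) t].

End EmpiricalDistribution.

(* sup over all real t; the set is bounded when F and G take values in [0, 1]. *)
Definition kolmogorov_dist {R : realType} (F G : R -> R) : R :=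
  sup (range (fun t => `|F t - G t|)).

Definition has_density_bounded_by {R : realType} (F : R -> R) (M : R) : Prop :=
  exists f : R -> R,
    [/\ measurable_fun setT f,
        forall t, 0 <= f t <= M &
        forall t,
          ((F t)%:E = \int[lebesgue_measure]_(u in `]-oo, t]) (f u)%:E)%E].

(* Main.v *)
Require Import Defs.
From HB Require Import structures.
From mathcomp Require Import all_boot all_order all_algebra.
From mathcomp Require Import all_classical all_reals all_analysis.
From mathcomp Require Import measurable_realfun ring lra.
Import Order.TTheory GRing.Theory Num.Theory.
Import numFieldNormedType.Exports.
Local Open Scope classical_set_scope.
Local Open Scope ring_scope.

(** Let phi be the logistic function and b = phi' = phi (1 - phi), and put
    G = 1/n sum_i phi((t - x_i)/h), B = 1/n sum_i b((t - x_i)/h).  Since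
    b^2 <= b and b'^2 <= b, both squared gradients are at most B / (n h^2).
    Herbst's argument applied to tau (G + w(tau) B), with a linearly decreasing
    weight w that vanishes at the final time, therefore bounds the Laplace
    transform of G - E G by that of the constant E B <= 2 M h: the bump B pays
    for its own gradient, which turns the exponent r^4 given by a crude
    Lipschitz bound into r^3.  The logistic kernel is not compactly supported,
    but it is a mixture of indicators of half-lines; hence if D = ||F_n - F|| is
    nearly attained at t, then |G - E G| >= 4/10 D at t + 8 h or t - 8 h with
    h = r / (160 M), the tails of the kernel contributing at least - D times
    their mass.  A union bound over about 20/r quantiles of F gives the tail
    estimate up to the factor 4/r, and the expectation follows by splitting at
    r = K beta log^(1/3)(1 + 1/beta). *)

Set Implicit Arguments.
Unset Strict Implicit.
Unset Printing Implicit Defensive.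

(** [LSI] is granted for bounded smooth functions only, so the half-line indicators in F_n must be
    smoothed. The logistic kernel is convenient because phi' = phi - phi^2 makes every derivative a
    polynomial in phi, and smoothness follows by induction on the order. With h of order r / M the
    mean of B is of order r, like the deviation itself; the Laplace transform is then needed at one
    time only, and the exponent is the deviation r times n h^2 / s, where s is the LSI constant
    sigma^2. No derivative is taken under the integral sign: the monotonicity behind Herbst's
    argument comes from a finite-step inequality with quadratic error. No convolution integral is
    computed either: means of smoothed functions are squeezed between finite averages of F along
    quantiles of the kernel. The density enters as a Lipschitz bound on F. Since F_n is monotone, a
    positive discrepancy persists to the right of a point and a negative one to its left, which
    dictates the direction of every shift. *)

(** * Functions of class C^k on R^n *)

Section ClassC.
Context {R : realType} {n : nat}.
Implicit Types (g : 'rV[R]_n -> R) (k : nat).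

(** Only directional derivatives are at hand, not differentiability on R^n; restricting to a line
    gives access to the one-variable chain rule. *)
Lemma is_derive_line g (x v : 'rV[R]_n) (dg : R) :
  is_derive x v g dg <-> is_derive (0 : R) 1 (fun h : R => g (h *: v + x)) dg.
Proof.
have E : (fun h : R => h^-1 *: (g (h *: v + x) - g x)) =
  (fun h : R => h^-1 *: (g ((h *: (1 : R) + 0) *: v + x) - g (0 *: v + x))).
  by apply: funext => h; rewrite addr0 scale0r add0r /GRing.scale /= mulr1.
split => -[d e]; split.
- by move: d; rewrite /derivable E.
- by rewrite -e /derive E.
- by move: d; rewrite /derivable -E.
- by rewrite -e /derive -E.
Qed.

Lemma is_derive_comp (s : R -> R) (ds : R) g (x v : 'rV[R]_n) (dg : R) :
  is_derive (g x) 1 s ds -> is_derive x v g dg ->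
  is_derive x v (s \o g) (dg * ds).
Proof.
move=> hs /is_derive_line hg; apply/is_derive_line.
have hs' : is_derive (g (0 *: v + x)) 1 s ds by rewrite scale0r add0r.
rewrite mulrC.
exact: (@is_derive1_comp R s (fun h : R => g (h *: v + x)) 0 ds dg hs' hg).
Qed.

Lemma class_C_continuous k g : class_C k g -> continuous g.
Proof. by case: k => [|k] []. Qed.

Lemma class_CS k g : class_C k.+1 g -> class_C k g.
Proof.
elim: k g => [|k IH] g [cg H]; first by split.
split => // i; have [dg Cg] := H i; split => //; exact: IH.
Qed.

Lemma class_C_partial k g (dg : 'I_n -> 'rV[R]_n -> R) :
    continuous g ->
    (forall i x, is_derive x (delta_mx 0 i) g (dg i x)) ->
    (forall i, class_C k (dg i)) ->
  @class_C R n k.+1 g.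
Proof.
move=> cg hdg Cdg; split => // i; split => [x|]; first by case: (hdg i x).
suff -> : partial i g = dg i by [].
by apply: funext => x; rewrite /partial; case: (hdg i x).
Qed.

Lemma class_C_is_derive k g i x : class_C k.+1 g ->
  is_derive x (delta_mx 0 i) g (partial i g x).
Proof. by move=> [_ /(_ i)[dg _]]; exact: derivableP. Qed.

Lemma class_C_cst k (a : R) : class_C k (fun _ : 'rV[R]_n => a).
Proof.
elim: k a => [|k IH] a.
  by split => //; exact: cst_continuous.
have H (i : 'I_n) (x : 'rV[R]_n) :
  is_derive x (delta_mx 0 i) (fun _ : 'rV[R]_n => a) 0 by exact: is_derive_cst.
apply: (class_C_partial (dg := fun _ _ => 0) _ H) => [|i]; last exact: IH.
exact: cst_continuous.
Qed.

Lemma class_CD k g1 g2 : class_C k g1 -> class_C k g2 ->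
  class_C k (fun x => g1 x + g2 x).
Proof.
elim: k g1 g2 => [|k IH] g1 g2 C1 C2.
  have c1 := class_C_continuous C1; have c2 := class_C_continuous C2.
  by split => // x; apply: continuousD; [exact: c1|exact: c2].
apply: (@class_C_partial _ _ (fun i x => partial i g1 x + partial i g2 x)).
- move=> x; apply: continuousD.
    exact: (class_C_continuous C1).
  exact: (class_C_continuous C2).
- move=> i x.
  exact: (is_deriveD (class_C_is_derive i x C1) (class_C_is_derive i x C2)).
- by move=> i; case: C1 => _ /(_ i)[_ H1]; case: C2 => _ /(_ i)[_ H2]; exact: IH.
Qed.

Lemma class_CM k g1 g2 : class_C k g1 -> class_C k g2 ->
  class_C k (fun x => g1 x * g2 x).
Proof.
elim: k g1 g2 => [|k IH] g1 g2 C1 C2.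
  have c1 := class_C_continuous C1; have c2 := class_C_continuous C2.
  by split => // x; apply: continuousM; [exact: c1|exact: c2].
apply: (@class_C_partial _ _
  (fun i x => g1 x * partial i g2 x + g2 x * partial i g1 x)).
- move=> x; apply: continuousM.
    exact: (class_C_continuous C1).
  exact: (class_C_continuous C2).
- move=> i x.
  exact: (is_deriveM (class_C_is_derive i x C1) (class_C_is_derive i x C2)).
- move=> i; have C1' := class_CS C1; have C2' := class_CS C2.
  case: C1 => _ /(_ i)[_ H1]; case: C2 => _ /(_ i)[_ H2].
  by apply: class_CD; exact: IH.
Qed.

Lemma class_C_sum k I (r : seq I) (g : I -> 'rV[R]_n -> R) :
  (forall i, class_C k (g i)) -> class_C k (fun x => \sum_(i <- r) g i x).
Proof.
move=> Cg; elim: r => [|i r IH].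
  rewrite (_ : (fun _ => _) = fun=> 0); first exact: class_C_cst.
  by apply: funext => x; rewrite big_nil.
rewrite (_ : (fun _ => _) = fun x => g i x + \sum_(j <- r) g j x).
  exact: class_CD.
by apply: funext => x; rewrite big_cons.
Qed.

(* A function solving the autonomous polynomial equation s' = a s + b s^2:
   both the exponential and the logistic function do. *)
Lemma class_C_comp (s : R -> R) (a b : R) k g :
    (forall y : R, is_derive y 1 s (a * s y + b * (s y * s y))) ->
  class_C k g -> class_C k (s \o g).
Proof.
move=> hs.
have cs : continuous s.
  move=> y; apply: differentiable_continuous.
  by apply/derivable1_diffP; case: (hs y).
elim: k g => [|k IH] g Cg.
  split => // x; apply: continuous_comp; last exact: cs.
  exact: (class_C_continuous Cg).
apply: (@class_C_partial _ _ (fun i x =>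
  partial i g x * (a * s (g x) + b * (s (g x) * s (g x))))).
- move=> x; apply: continuous_comp; last exact: cs.
  exact: (class_C_continuous Cg).
- by move=> i x; exact: (is_derive_comp (hs (g x)) (class_C_is_derive i x Cg)).
- move=> i; have Cs := IH g (class_CS Cg).
  case: Cg => _ /(_ i)[_ H1]; apply: class_CM => //; apply: class_CD.
    by apply: class_CM => //; exact: class_C_cst.
  by apply: class_CM; [exact: class_C_cst|apply: class_CM].
Qed.

Lemma is_derive_coord (i j : 'I_n) (x : 'rV[R]_n) :
  is_derive x (delta_mx 0 i) (fun x : 'rV[R]_n => x 0 j) (i == j)%:R.
Proof.
apply/is_derive_line.
rewrite (_ : (fun _ => _) = fun h : R => (i == j)%:R * h + x 0 j).
  apply: is_derive_eq; last first.
  by rewrite !addr0 /GRing.scale /= mulr1.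
by apply: funext => h; rewrite !mxE eqxx /= eq_sym mulrC.
Qed.

Lemma class_C_coord k (j : 'I_n) : class_C k (fun x : 'rV[R]_n => x 0 j).
Proof.
have c : continuous (fun x : 'rV[R]_n => x 0 j) by exact: coord_continuous.
case: k => [|k]; first by split.
apply: (@class_C_partial _ _ (fun i _ => (i == j)%:R)) => // [i x|i].
  exact: is_derive_coord.
exact: class_C_cst.
Qed.

End ClassC.

(** * Means of bounded measurable functions *)

Section BoundedExpectation.
Context d (T : measurableType d) (R : realType) (mu : probability T R).
Implicit Types f g : T -> R.

(** Implies integrability under a probability measure and is stable under sums, products and [expR],
    so it serves as the side condition of all the rules for means. *)
Definition bounded_measurable f :=
  measurable_fun setT f /\ exists K, forall x, `|f x| <= K.

Lemma bounded_measurable_integrable f : bounded_measurable f ->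
  mu.-integrable setT (EFin \o f).
Proof.
move=> [mf [K fK]]; apply: measurable_bounded_integrable => //.
  exact: (le_lt_trans (probability_le1 mu measurableT) (ltry 1)).
exists K; split; first exact: num_real.
by move=> M KM x _; exact: le_trans (fK x) (ltW KM).
Qed.

Lemma bounded_measurable_cst a : bounded_measurable (fun=> a).
Proof. by split; [exact: measurable_cst|exists `|a|]. Qed.

Lemma bounded_measurableD f g : bounded_measurable f -> bounded_measurable g ->
  bounded_measurable (fun x => f x + g x).
Proof.
move=> [mf [K fK]] [mg [L gL]]; split; first exact: measurable_funD.
by exists (K + L) => x; apply: le_trans (ler_normD _ _) _; exact: lerD.
Qed.

Lemma bounded_measurableM f g : bounded_measurable f -> bounded_measurable g ->
  bounded_measurable (fun x => f x * g x).
Proof.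
move=> [mf [K fK]] [mg [L gL]]; split; first exact: measurable_funM.
by exists (K * L) => x; rewrite normrM ler_pM.
Qed.

Lemma bounded_measurableZ a f : bounded_measurable f ->
  bounded_measurable (fun x => a * f x).
Proof. exact: bounded_measurableM (bounded_measurable_cst a). Qed.

Lemma bounded_measurableN f : bounded_measurable f ->
  bounded_measurable (fun x => - f x).
Proof.
move=> /(bounded_measurableZ (-1)).
by under eq_fun do rewrite mulN1r.
Qed.

Lemma bounded_measurable_sum I (r : seq I) (f : I -> T -> R) :
    (forall i, bounded_measurable (f i)) ->
  bounded_measurable (fun x => \sum_(i <- r) f i x).
Proof.
move=> bf; elim: r => [|i r IH].
  by under eq_fun do rewrite big_nil; exact: bounded_measurable_cst.
by under eq_fun do rewrite big_cons; exact: bounded_measurableD.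
Qed.

Lemma bounded_measurable_expR f : bounded_measurable f ->
  bounded_measurable (fun x => expR (f x)).
Proof.
move=> [mf [K fK]]; split; first exact: measurableT_comp.
exists (expR K) => x; rewrite ger0_norm ?expR_ge0 // ler_expR.
exact: le_trans (ler_norm _) (fK x).
Qed.

Lemma mean_cst a : \int[mu]_x a = a.
Proof.
rewrite (Rintegral_cst mu measurableT) [X in fine X](@probability_setT _ _ _ mu).
by rewrite mulr1.
Qed.

Lemma meanD f g : bounded_measurable f -> bounded_measurable g ->
  \int[mu]_x (f x + g x) = \int[mu]_x f x + \int[mu]_x g x.
Proof.
by move=> bf bg; apply: RintegralD => //; exact: bounded_measurable_integrable.
Qed.

Lemma meanZ a f : bounded_measurable f ->
  \int[mu]_x (a * f x) = a * \int[mu]_x f x.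
Proof.
by move=> bf; apply: RintegralZl => //; exact: bounded_measurable_integrable.
Qed.

Lemma meanN f : bounded_measurable f -> \int[mu]_x (- f x) = - \int[mu]_x f x.
Proof.
by move=> bf; rewrite -[RHS]mulN1r -meanZ //; under eq_fun do rewrite -mulN1r.
Qed.

Lemma mean_sum I (r : seq I) (f : I -> T -> R) :
    (forall i, bounded_measurable (f i)) ->
  \int[mu]_x (\sum_(i <- r) f i x) = \sum_(i <- r) \int[mu]_x f i x.
Proof.
move=> bf; elim: r => [|i r IH].
  by under eq_fun do rewrite big_nil; rewrite big_nil mean_cst.
under eq_fun do rewrite big_cons.
by rewrite big_cons meanD ?IH //; exact: bounded_measurable_sum.
Qed.

Lemma le_mean f g : bounded_measurable f -> bounded_measurable g ->
  (forall x, f x <= g x) -> \int[mu]_x f x <= \int[mu]_x g x.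
Proof.
by move=> bf bg fg; apply: le_Rintegral => //;
  exact: bounded_measurable_integrable.
Qed.

Lemma EFin_mean f : bounded_measurable f ->
  (\int[mu]_x f x)%:E = (\int[mu]_x (f x)%:E)%E.
Proof.
move=> bf; rewrite /Rintegral fineK //.
exact: integrable_fin_num (bounded_measurable_integrable bf).
Qed.

Lemma mean_gt0 f (e : R) : bounded_measurable f -> 0 < e ->
  (forall x, e <= f x) -> 0 < \int[mu]_x f x.
Proof.
move=> bf e0 ef; apply: lt_le_trans e0 _; rewrite -[leLHS]mean_cst.
by apply: le_mean => //; exact: bounded_measurable_cst.
Qed.

Lemma exponential_markov f (a : R) : bounded_measurable f ->
  (mu [set x | (a <= f x)%R] <=
    (expR (- a) * \int[mu]_x expR (f x))%:E)%E.
Proof.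
move=> bf; have bef := bounded_measurable_expR bf.
have mA : measurable [set x | a <= f x].
  have -> : [set x | a <= f x] = setT `&` f @^-1` `[a, +oo[%classic.
    by apply/seteqP; split => x /=; rewrite in_itv /= andbT // => -[].
  by apply: (proj1 bf) => //; exact: measurable_itv.
rewrite -meanZ // EFin_mean; last exact: bounded_measurableZ.
rewrite -(setIT [set x | _]) -integral_indic //.
apply: ge0_le_integral => //=.
- apply/measurable_EFinP; exact: measurable_indic.
- by apply/measurable_EFinP; have [] := bounded_measurableZ (expR (- a)) bef.
- move=> x _; rewrite lee_fin indicE; case: (boolP (x \in _)) => [|_] /=.
    by rewrite inE /= => ax; rewrite -expRD -expR0 ler_expR addrC subr_ge0.
  by rewrite mulr_ge0 ?expR_ge0.
Qed.

End BoundedExpectation.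

(** * Entropy of exponentials under the logarithmic Sobolev inequality *)

Section Herbst.
Context {R : realType} {n : nat}.
Variables (mu : probability (euclid R n) R) (s : R).
Implicit Types (f g G B V : 'rV[R]_n -> R).

Lemma continuous_measurable_euclid f : continuous f ->
  measurable_fun setT (f : euclid R n -> R).
Proof.
move=> /continuousP cf; apply: (measurability _ (RGenOpens.measurableE R)).
move=> _ [_ [a [b ->] <-]]; rewrite setTI; apply: sub_sigma_algebra.
exact/cf/interval_open.
Qed.

Lemma smooth_bounded_measurable f (K : R) : smooth f -> (forall x, `|f x| <= K) ->
  bounded_measurable (f : euclid R n -> R).
Proof.
move=> sf fK; split; last by exists K.
exact: (continuous_measurable_euclid (class_C_continuous (sf 0%N))).
Qed.

Lemma is_derive_expR_autonomous (y : R) :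
  is_derive y (1 : R) expR (1 * expR y + 0 * (expR y * expR y)).
Proof. by apply: is_derive_eq; rewrite mul1r mul0r addr0. Qed.

Lemma smooth_cst (a : R) : smooth (fun _ : 'rV[R]_n => a).
Proof. by move=> k; exact: class_C_cst. Qed.

Lemma smoothD f g : smooth f -> smooth g -> smooth (fun x => f x + g x).
Proof. by move=> sf sg k; exact: class_CD. Qed.

Lemma smoothM f g : smooth f -> smooth g -> smooth (fun x => f x * g x).
Proof. by move=> sf sg k; exact: class_CM. Qed.

Lemma smoothZ (a : R) f : smooth f -> smooth (fun x => a * f x).
Proof. by move=> sf; exact: (smoothM (smooth_cst a) sf). Qed.

Lemma smooth_expR f : smooth f -> smooth (fun x => expR (f x)).
Proof. by move=> sf k; exact: (class_C_comp is_derive_expR_autonomous). Qed.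

Lemma grad_sq_lincomb (a b : R) G B x : smooth G -> smooth B ->
  grad_sq (fun x => a * G x + b * B x) x <=
    2 * a ^+ 2 * grad_sq G x + 2 * b ^+ 2 * grad_sq B x.
Proof.
move=> sG sB; rewrite /grad_sq !mulr_sumr -big_split /=.
apply: ler_sum => i _.
have dG := class_C_is_derive i x (sG 1%N); have dB := class_C_is_derive i x (sB 1%N).
have [_ e] := is_deriveD (is_deriveZ a dG) (is_deriveZ b dB).
have -> : partial i (fun x => a * G x + b * B x) x =
  a * partial i G x + b * partial i B x by rewrite {1}/partial -[RHS]e.
set p := partial i G x; set q := partial i B x.
have := sqr_ge0 (a * p - b * q); nra.
Qed.

Lemma grad_sq_expR (c : R) f x : smooth f ->
  grad_sq (fun x => expR (c * f x)) x = c ^+ 2 * grad_sq f x * expR (c * f x) ^+ 2.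
Proof.
move=> sf; rewrite /grad_sq mulr_sumr mulr_suml; apply: eq_bigr => i _.
have df := class_C_is_derive i x (sf 1%N).
have de := @is_derive_expR R (c * f x).
have [_ e] := is_derive_comp de (is_deriveZ c df).
have -> : partial i (fun x => expR (c * f x)) x =
  c * partial i f x * expR (c * f x) by rewrite {1}/partial -[RHS]e.
by rewrite !exprMn.
Qed.

(** [LSI] is applied to [expR (f / 2)], whose squared gradient is a quarter of [grad_sq f * expR f];
    this turns [2 s] into [s / 2]. The bounded majorant [V] stands in for [grad_sq f], since a
    bounded smooth function may have an unbounded gradient. *)
Lemma LSI_entropy_expR f V (K : R) : 0 <= s -> LSI mu s -> smooth f ->
    (forall x, `|f x| <= K) ->
    bounded_measurable (V : euclid R n -> R) ->
    (forall x, grad_sq f x <= V x) ->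
  \int[mu]_x (f x * expR (f x))
      - \int[mu]_x expR (f x) * ln (\int[mu]_x expR (f x)) <=
    s / 2 * \int[mu]_x (V x * expR (f x)).
Proof.
move=> s0 lsi sf fK bV fV; set L := \int[mu]_x expR (f x).
have bf := smooth_bounded_measurable sf fK.
have be := bounded_measurable_expR bf.
have sg := smooth_expR (smoothZ (1/2) sf).
have gK x : `|expR (1/2 * f x)| <= expR K.
  rewrite ger0_norm ?expR_ge0 // ler_expR.
  have := fK x; rewrite ler_norml => /andP[h1 h2].
  have := le_trans (normr_ge0 _) (fK x); lra.
have g2 x : expR (1/2 * f x) ^+ 2 = expR (f x).
  by rewrite expr2 -expRD; congr expR; lra.
have := lsi _ (ex_intro _ _ gK) sg.
rewrite /Ent.
under eq_integral do rewrite g2 expRK mulrC.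
under eq_Rintegral do rewrite g2.
rewrite -(EFin_mean mu (bounded_measurableM bf be)).
move=> h.
have mgrad : measurable_fun setT
    (fun x : euclid R n => grad_sq (fun x => expR (1/2 * f x)) x).
  apply: continuous_measurable_euclid => x.
  have : class_C 0%N (grad_sq (fun x => expR (1/2 * f x))).
    apply: class_C_sum => i; have [_ /(_ i)[_ Ci]] := sg 1%N.
    exact: class_CM.
  by move=> /class_C_continuous; exact.
have h2 : (\int[mu]_x (grad_sq (fun x => expR (1/2 * f x)) x)%:E <=
           (1/4 * \int[mu]_x (V x * expR (f x)))%:E)%E.
  rewrite -meanZ; last exact: bounded_measurableM.
  rewrite EFin_mean; last exact/bounded_measurableZ/bounded_measurableM.
  apply: ge0_le_integral => //=.
  - by move=> x _; rewrite lee_fin sumr_ge0 // => i _; exact: sqr_ge0.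
  - exact/measurable_EFinP.
  - apply/measurable_EFinP.
    by have [] := bounded_measurableZ (1/4) (bounded_measurableM bV be).
  - move=> x _; rewrite lee_fin grad_sq_expR // g2.
    by have := ler_wpM2r (expR_ge0 (f x)) (fV x); lra.
have s20 : (0 <= (2 * s)%:E)%E by rewrite lee_fin; lra.
have := le_trans h (lee_wpmul2l s20 h2).
rewrite -EFinM -EFinB lee_fin -/L => /le_trans; apply.
by rewrite [leRHS](_ : _ = 2 * s * (1/4 * \int[mu]_x (V x * expR (f x)))) //; lra.
Qed.

End Herbst.

(** * Elementary inequalities for the monotonicity argument *)

(** Substitute for a nonpositive derivative: over N equal steps the errors add up to K (b - a)^2 /
    N, which tends to 0. *)
Lemma quadratic_growth_le {R : realType} (v : R -> R) (a b K : R) : a < b ->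
    (forall x y, a <= x -> x < y -> y <= b -> v y <= v x + K * (y - x) ^+ 2) ->
  v b <= v a.
Proof.
move=> ab vK.
have H (N : nat) : (0 < N)%N -> v b <= v a + `|K| * (b - a) ^+ 2 / N%:R.
  move=> N0; have N0' : (0 : R) < N%:R by rewrite ltr0n.
  set d := (b - a) / N%:R.
  have d0 : 0 < d by rewrite divr_gt0 ?subr_gt0.
  have step k : (k <= N)%N -> v (a + k%:R * d) <= v a + k%:R * (K * d ^+ 2).
    elim: k => [|k IH] kN; first by rewrite !mul0r !addr0.
    have := IH (ltnW kN).
    have kd : 0 <= k%:R * d by rewrite mulr_ge0 ?ler0n ?ltW.
    have kb : (k.+1)%:R * d <= b - a.
      rewrite -[leRHS](divfK (lt0r_neq0 N0')) -/d mulrC.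
      by rewrite ler_pM2l // ler_nat.
    have := vK (a + k%:R * d) (a + k.+1%:R * d).
    rewrite -natr1 in kb *; move=> h1 h2.
    have := h1 _ _ _; rewrite [in X in K * X ^+ 2](_ : _ - _ = d); last ring.
    move=> /(_ ltac:(lra) ltac:(lra) ltac:(lra)); lra.
  have := step N (leqnn N).
  have -> : N%:R * d = b - a by rewrite mulrC divfK // lt0r_neq0.
  rewrite addrC subrK => /le_trans; apply; rewrite lerD2l.
  have -> : N%:R * (K * d ^+ 2) = K * (b - a) ^+ 2 / N%:R.
    by rewrite /d; field; rewrite lt0r_neq0.
  rewrite ler_pM2r ?invr_gt0 // ler_wpM2r ?sqr_ge0 //; exact: ler_norm.
apply/ler_addgt0Pr => e e0.
set C := `|K| * (b - a) ^+ 2 in H.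
have C0 : 0 <= C by rewrite mulr_ge0 ?sqr_ge0.
have [N NC] : exists N : nat, C / e < N%:R.
  exists (Num.bound (C / e)).
  by apply: archi_boundP; rewrite divr_ge0 // ltW.
have N0 : (0 < N)%N.
  by rewrite -(ltr_nat R); apply: le_lt_trans NC; rewrite divr_ge0 // ltW.
apply: (le_trans (H N N0)); rewrite lerD2l ler_pdivrMr ?ltr0n //.
by rewrite mulrC -ler_pdivrMr // ltW.
Qed.

(** From e^(-x) >= 1 - x one gets e^x <= 1 / (1 - x), and (1 - x)(1 + x + 2 x^2) = 1 + x^2 (1 - 2
    x). *)
Lemma expR_le_quadratic {R : realType} (x : R) : x <= 1/2 ->
  expR x <= 1 + x + 2 * x ^+ 2.
Proof.
move=> x12; have h := expR_ge1Dx (- x).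
have p : 0 < expR x := expR_gt0 x.
have e : expR x * expR (- x) = 1 by rewrite -expRD subrr expR0.
have x2 := sqr_ge0 x.
have q : 0 <= 1 + x + 2 * x ^+ 2 by have := sqr_ge0 (1 + 2 * x); nra.
have : expR x * (1 - x) <= 1 by rewrite -[leRHS]e ler_pM2l.
rewrite -ler_pdivlMr; last by lra.
move=> /le_trans; apply; rewrite ler_pdivrMr; last by lra.
have : 0 <= x ^+ 2 * (1 - 2 * x) by rewrite mulr_ge0 //; lra.
rewrite expr2; nra.
Qed.

(** * Herbst's argument for a function whose gradient is controlled by a self-bounding one *)

Section SelfBounded.
Context {R : realType} {n : nat}.
Variables (mu : probability (euclid R n) R) (s a : R) (G B : 'rV[R]_n -> R).
Hypotheses (s0 : 0 < s) (a0 : 0 < a) (lsi : LSI mu s).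
Hypotheses (sG : smooth G) (sB : smooth B).
Hypotheses (G1 : forall x, `|G x| <= 1) (B01 : forall x, 0 <= B x <= 1).
Hypotheses (dG : forall x, grad_sq G x <= a * B x)
           (dB : forall x, grad_sq B x <= a * B x).

Let A := s * a.

Let A0 : 0 < A. Proof. exact: mulr_gt0. Qed.

(* The weight [1 - 2 A t] of [B] is chosen so that the entropy bound for
   [exp (t (G + w B))], which costs [2 A t^2 E[B exp]], is exactly paid for by
   the decrease of [w]: then [t |-> log_laplace t / t] is nonincreasing. *)
Let f t x := t * G x + t * (1 - 2 * A * t) * B x.

Let log_laplace t := ln (\int[mu]_x expR (f t x)).

Let bG : bounded_measurable (G : euclid R n -> R).
Proof. exact: smooth_bounded_measurable sG G1. Qed.

Let B1 x : `|B x| <= 1.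
Proof. by have /andP[h1 h2] := B01 x; rewrite ger0_norm. Qed.

Let bB : bounded_measurable (B : euclid R n -> R).
Proof. exact: smooth_bounded_measurable sB B1. Qed.

Let sf t : smooth (f t).
Proof. by apply: smoothD; exact: smoothZ. Qed.

Let bf t : bounded_measurable (f t : euclid R n -> R).
Proof. by apply: bounded_measurableD; exact: bounded_measurableZ. Qed.

Let weight t : 0 < t -> t <= (2 * A)^-1 -> 0 <= 2 * A * t <= 1.
Proof.
move=> t0 tA; have A2 : 0 < 2 * A by rewrite mulr_gt0.
apply/andP; split; first by rewrite mulr_ge0 ?ltW.
by rewrite -[leRHS](mulfV (lt0r_neq0 A2)) ler_pM2l.
Qed.

Let f_le t x : 0 < t -> t <= (2 * A)^-1 -> `|f t x| <= 2 * t.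
Proof.
move=> t0 tA; have /andP[w0 w1] := weight t0 tA.
have /andP[b0 b1] := B01 x; have := G1 x; rewrite ler_norml => /andP[g1 g2].
have h1 : 0 <= (1 - 2 * A * t) * B x by rewrite mulr_ge0 // subr_ge0.
have h2 : (1 - 2 * A * t) * B x <= 1 by rewrite mulr_ile1 ?subr_ge0 //; lra.
rewrite /f -mulrA -mulrDr normrM gtr0_norm // mulrC ler_pM2r // ler_norml; lra.
Qed.

Let laplace_gt0 t : 0 < t -> t <= (2 * A)^-1 -> 0 < \int[mu]_x expR (f t x).
Proof.
move=> t0 tA; apply: (@mean_gt0 _ _ _ _ _ (expR (- (2 * t)))).
- exact: bounded_measurable_expR.
- exact: expR_gt0.
- by move=> x; rewrite ler_expR; have := f_le x t0 tA; rewrite ler_norml => /andP[].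
Qed.

(** By (p + q)^2 <= 2 p^2 + 2 q^2 and a weight in [0, 1], the squared gradient of [f t] is at most 4
    t^2 a B; the factor s / 2 of the entropy bound makes this 2 A t^2 B. *)
Let entropy_f t : 0 < t -> t <= (2 * A)^-1 ->
  \int[mu]_x (f t x * expR (f t x))
      - \int[mu]_x expR (f t x) * log_laplace t <=
    2 * A * t ^+ 2 * \int[mu]_x (B x * expR (f t x)).
Proof.
move=> t0 tA; have /andP[w0 w1] := weight t0 tA.
have be := bounded_measurable_expR (bf t).
have bV : bounded_measurable ((fun x => 4 * t ^+ 2 * a * B x) : euclid R n -> R).
  exact: bounded_measurableZ.
have fV x : grad_sq (f t) x <= 4 * t ^+ 2 * a * B x.
  apply: le_trans (grad_sq_lincomb _ _ _ sG sB) _.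
  have /andP[b0 b1] := B01 x; have := dG x; have := dB x.
  set p := grad_sq G x; set q := grad_sq B x; set w := 1 - 2 * A * t => qB pB.
  have q0 : 0 <= q by apply: sumr_ge0 => i _; exact: sqr_ge0.
  have w2 : w ^+ 2 <= 1 by rewrite expr_le1 // /w; lra.
  have t2 : 0 <= t ^+ 2 by exact: sqr_ge0.
  have h1 : t ^+ 2 * p <= t ^+ 2 * (a * B x) by exact: ler_wpM2l.
  have h2 : t ^+ 2 * (w ^+ 2 * q) <= t ^+ 2 * (a * B x).
    apply: ler_wpM2l => //; apply: le_trans qB.
    by rewrite -[leRHS]mul1r ler_wpM2r.
  by rewrite exprMn; lra.
have := LSI_entropy_expR (ltW s0) lsi (sf t) (fun x => f_le x t0 tA) bV fV.
move=> /le_trans; apply.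
have bBe := bounded_measurableM bB be.
have -> : \int[mu]_x (4 * t ^+ 2 * a * B x * expR (f t x)) =
          4 * t ^+ 2 * a * \int[mu]_x (B x * expR (f t x)).
  by rewrite -meanZ //; apply: eq_Rintegral => x _; rewrite mulrA.
by rewrite /A; lra.
Qed.

(** Finite-step form of the sign of the derivative. Since f x = (x / y) f y + 2 A x (y - x) B, the
    entropy cost 2 A y (y - x) E[B exp (f y)] meets the gain 2 A x (y - x) E[B exp (f y)] from the
    weight; only their difference, quadratic in y - x, is left. *)
Let log_laplace_step x y : 0 < x -> x < y -> y <= (2 * A)^-1 ->
  log_laplace y / y <= log_laplace x / x + 2 * A / x * (y - x) ^+ 2.
Proof.
move=> x0 xy yA; have y0 := lt_trans x0 xy; have xA := le_trans (ltW xy) yA.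
set L := \int[mu]_z expR (f y z).
have L0 : 0 < L := laplace_gt0 y0 yA.
set c := log_laplace x - log_laplace y.
have bey := bounded_measurable_expR (bf y).
have bex := bounded_measurable_expR (bf x).
have bBe := bounded_measurableM bB bey.
have bfe := bounded_measurableM (bf y) bey.
set EB := \int[mu]_z (B z * expR (f y z)).
set Ef := \int[mu]_z (f y z * expR (f y z)).
have EBL : EB <= L.
  apply: le_mean => // z; rewrite ger_pMl ?expR_gt0 //.
  by have /andP[] := B01 z.
have ent : Ef - L * log_laplace y <= 2 * A * y ^+ 2 * EB := entropy_f y0 yA.
(* Jensen's inequality for the law tilted by exp (f y) / L, as e^u >= 1 + u with u = f x - f y - c;
   the constant [c] normalises e^u to tilted mean 1. *)
have jensen : - (c * L) <= (y - x) / y * Ef - 2 * A * x * (y - x) * EB.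
  have cL : L = \int[mu]_z (expR (- c) * expR (f x z)).
    rewrite meanZ // /c opprB expRD expRN /log_laplace !lnK ?posrE ?laplace_gt0 //.
    by rewrite -mulrA mulVf ?mulr1 // lt0r_neq0 ?laplace_gt0.
  have : \int[mu]_z ((1 - c) * expR (f y z) +
      (- ((y - x) / y) * (f y z * expR (f y z)) +
        2 * A * x * (y - x) * (B z * expR (f y z)))) <= L.
    rewrite [leRHS]cL; apply: le_mean => [||z].
    - by do ?apply: bounded_measurableD; apply: bounded_measurableZ.
    - exact: bounded_measurableZ.
    - have -> : expR (- c) * expR (f x z) = expR (f x z - f y z - c) * expR (f y z).
        by rewrite -!expRD; congr expR; ring.
      have -> : (1 - c) * expR (f y z) + (- ((y - x) / y) * (f y z * expR (f y z)) +
          2 * A * x * (y - x) * (B z * expR (f y z))) =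
          (1 + (f x z - f y z - c)) * expR (f y z).
        by rewrite /f; field; rewrite lt0r_neq0.
      by rewrite ler_wpM2r ?expR_ge0 // expR_ge1Dx.
  rewrite meanD; [|exact: bounded_measurableZ|
    by apply: bounded_measurableD; exact: bounded_measurableZ].
  rewrite meanD; [|exact: bounded_measurableZ..].
  rewrite !meanZ // -/L -/EB -/Ef; lra.
have k0 : 0 < (y - x) / y by rewrite divr_gt0 // subr_gt0.
have h1 : (y - x) / y * (Ef - L * log_laplace y) <=
    (y - x) / y * (2 * A * y ^+ 2 * EB) by rewrite ler_pM2l.
have h2 : (y - x) / y * (2 * A * y ^+ 2 * EB) = 2 * A * y * (y - x) * EB.
  by field; rewrite lt0r_neq0.
have h3 : 2 * A * (y - x) ^+ 2 * EB <= 2 * A * (y - x) ^+ 2 * L.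
  by rewrite ler_wpM2l // mulr_ge0 ?sqr_ge0 ?mulr_ge0 ?ltW.
have : - c * L <= ((y - x) / y * log_laplace y + 2 * A * (y - x) ^+ 2) * L.
  by move: jensen h1 h3; rewrite h2; lra.
rewrite ler_pM2r // /c => h4.
have h5 : x * (log_laplace y / y) <= log_laplace x + 2 * A * (y - x) ^+ 2.
  have -> : x * (log_laplace y / y) = log_laplace y - (y - x) / y * log_laplace y.
    by field; rewrite lt0r_neq0.
  by rewrite lerBlDl [X in _ + X]addrC addrA; move: h4; rewrite opprB lerBlDr.
rewrite -(ler_pM2l x0) (le_trans h5) // le_eqVlt; apply/orP; left; apply/eqP.
by field; rewrite lt0r_neq0.
Qed.

(** Starting value of the monotone quantity. As |f x| <= 2 x, the condition x <= 1/4 allows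
    [expR_le_quadratic], whose quadratic term is then at most 8 x^2. *)
Let log_laplace_small x : 0 < x -> x <= (2 * A)^-1 -> x <= 1/4 ->
  log_laplace x / x <= \int[mu]_z G z + \int[mu]_z B z + 8 * x.
Proof.
move=> x0 xA x4.
have bex := bounded_measurable_expR (bf x).
have : \int[mu]_z expR (f x z) <=
    \int[mu]_z (1 + 8 * x ^+ 2 + (x * G z + x * B z)).
  apply: le_mean => [//||z].
    apply: bounded_measurableD; first exact: bounded_measurable_cst.
    by apply: bounded_measurableD; exact: bounded_measurableZ.
  have := f_le z x0 xA; rewrite ler_norml => /andP[f1 f2].
  apply: le_trans (expR_le_quadratic _) _; first by lra.
  have fq : f x z ^+ 2 <= 4 * x ^+ 2.
    have : 0 <= (2 * x - f x z) * (2 * x + f x z) by rewrite mulr_ge0 //; lra.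
    by lra.
  have /andP[b0 b1] := B01 z; have /andP[w0 w1] := weight x0 xA.
  have : x * ((1 - 2 * A * x) * B z) <= x * B z.
    by rewrite ler_pM2l // ler_piMl //; lra.
  by move: fq; rewrite {2}/f; lra.
rewrite meanD; [|exact: bounded_measurable_cst|
  by apply: bounded_measurableD; exact: bounded_measurableZ].
rewrite mean_cst meanD; [|exact: bounded_measurableZ..].
rewrite !meanZ // => h; rewrite ler_pdivrMr //.
have := laplace_gt0 x0 xA; rewrite /log_laplace; move: h.
set L := \int[mu]_z expR (f x z) => h L0.
have := @le_ln1Dx _ (L - 1); rewrite [1 + _](_ : _ = L); last by ring.
by move=> /(_ ltac:(lra)); lra.
Qed.

Lemma self_bounded_laplace :
  \int[mu]_x expR (G x / (2 * A)) <=
    expR ((\int[mu]_x G x + \int[mu]_x B x) / (2 * A)).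
Proof.
set m := \int[mu]_x G x + _; set t := (2 * A)^-1.
have t0 : 0 < t by rewrite invr_gt0 mulr_gt0.
have key : log_laplace t / t <= m.
  apply/ler_addgt0Pr => e e0.
  (* The error constant 2 A / x of a step blows up at 0, so monotonicity is used on [x, t] only; x
     <= e / 8 absorbs the error 8 x of the starting value. *)
  pose x := Num.min (t / 2) (Num.min (1/4) (e / 8)).
  have x0 : 0 < x by rewrite !lt_min !divr_gt0.
  have [xt x4 xe] : [/\ x <= t / 2, x <= 1/4 & x <= e / 8].
    by split; rewrite !ge_min lexx ?orbT.
  have xlt : x < t by lra.
  apply: le_trans (_ : log_laplace x / x <= _).
    apply: (@quadratic_growth_le _ (fun y => log_laplace y / y) x t (2 * A / x)) => //.
    move=> y z xy yz zt; apply: le_trans (log_laplace_step _ yz zt) _.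
      exact: lt_le_trans xy.
    rewrite lerD2l ler_wpM2r ?sqr_ge0 // ler_pM2l ?mulr_gt0 //.
    by rewrite lef_pV2 ?posrE //; exact: lt_le_trans xy.
  by apply: (le_trans (log_laplace_small x0 (ltW xlt) x4)); rewrite /m; lra.
have -> : \int[mu]_x expR (G x / (2 * A)) = \int[mu]_x expR (f t x).
  apply: eq_Rintegral => x _; congr expR.
  by rewrite /f /t mulfV ?subrr ?mulr0 ?mul0r ?addr0 1?mulrC // lt0r_neq0 ?mulr_gt0.
rewrite -[leLHS]lnK ?posrE ?laplace_gt0 // ler_expR -/(log_laplace t).
by rewrite -ler_pdivrMr.
Qed.

End SelfBounded.

(** * The logistic function and its derivative *)

Section Logistic.
Context {R : realType}.
Implicit Types (y z p : R).

Definition logistic y : R := (1 + expR (- y))^-1.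

Definition logistic_bump y : R := logistic y - logistic y * logistic y.

Lemma logistic_gt0 y : 0 < logistic y.
Proof. by rewrite invr_gt0 addr_gt0 ?expR_gt0. Qed.

Lemma logistic_lt1 y : logistic y < 1.
Proof. by rewrite invf_lt1 ?addr_gt0 ?expR_gt0 // ltrDl expR_gt0. Qed.

Lemma ler_logistic y z : (logistic y <= logistic z) = (y <= z).
Proof.
by rewrite lef_pV2 ?posrE ?addr_gt0 ?expR_gt0 // lerD2l ler_expR lerN2.
Qed.

Lemma logistic_logit p : 0 < p < 1 -> logistic (ln (p / (1 - p))) = p.
Proof.
move=> /andP[p0 p1]; rewrite /logistic expRN lnK ?posrE ?divr_gt0 ?subr_gt0 //.
have -> : 1 + (p / (1 - p))^-1 = p^-1 by field; rewrite !lt0r_neq0 // subr_gt0.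
exact: invrK.
Qed.

Lemma logistic_bump_ge0 y : 0 <= logistic_bump y.
Proof.
by rewrite /logistic_bump; have := logistic_gt0 y; have := logistic_lt1 y; nra.
Qed.

Lemma logistic_bump_le1 y : logistic_bump y <= 1.
Proof.
by rewrite /logistic_bump; have := logistic_gt0 y; have := logistic_lt1 y; nra.
Qed.

(** The derivative is kept in the shape expected by [class_C_comp], with coefficients 1 and -1. *)
Lemma is_derive_logistic y :
  is_derive y (1 : R) logistic (1 * logistic y + (-1) * (logistic y * logistic y)).
Proof.
have p : 1 + expR (- y) != 0 by rewrite lt0r_neq0 // addr_gt0 ?expR_gt0.
rewrite /logistic; apply: is_derive_eq.
rewrite /GRing.scale /=; field; exact: p.
Qed.

Lemma is_derive_logistic_bump y :
  is_derive y (1 : R) logistic_bump ((1 - 2 * logistic y) * logistic_bump y).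
Proof.
have d := is_derive_logistic y.
rewrite /logistic_bump; apply: is_derive_eq.
rewrite /GRing.scale /=; ring.
Qed.

(** Reduces the mean of the bump to an increment of the smoothed distribution function, where the
    Lipschitz bound applies. With u = e^(-y) and v = 1 / e <= 1/2 it amounts to 1 + u v <= 2 (1 -
    v)(1 + u). *)
Lemma logistic_bump_le_increment y :
  logistic_bump y <= 2 * (logistic (y + 1) - logistic y).
Proof.
have e1 : 2 <= expR (1 : R) by have := expR_ge1Dx (1 : R); lra.
rewrite /logistic_bump /logistic.
have -> : expR (- (y + 1)) = expR (- y) * (expR 1)^-1.
  by rewrite -[(expR 1)^-1]expRN -expRD opprD.
set u := expR (- y); have u0 : 0 < u := expR_gt0 _.
have : (expR (1 : R))^-1 <= 2^-1 by rewrite lef_pV2 ?posrE //; lra.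
have : 0 < (expR (1 : R))^-1 by rewrite invr_gt0 expR_gt0.
set v := (expR 1)^-1 => v0 v1.
have p : 0 < 1 + u by lra.
have q : 0 < 1 + u * v by have := mulr_gt0 u0 v0; lra.
have -> : (1 + u)^-1 - (1 + u)^-1 * (1 + u)^-1 = u / (1 + u) ^+ 2.
  by field; rewrite lt0r_neq0.
have -> : (1 + u * v)^-1 - (1 + u)^-1 = u * (1 - v) / ((1 + u * v) * (1 + u)).
  by field; rewrite !lt0r_neq0.
rewrite ler_pdivrMr ?exprn_gt0 //.
have -> : 2 * (u * (1 - v) / ((1 + u * v) * (1 + u))) * (1 + u) ^+ 2 =
    2 * (u * (1 - v) * (1 + u)) / (1 + u * v).
  by field; rewrite !lt0r_neq0.
rewrite ler_pdivlMr //.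
have -> : 2 * (u * (1 - v) * (1 + u)) = u * (2 * (1 - v) * (1 + u)) by ring.
rewrite ler_pM2l //; nra.
Qed.

End Logistic.

(** * Smoothed empirical distribution functions and their gradients *)

Section Averages.
Context {R : realType} {n : nat}.
Hypothesis n_gt0 : (0 < n)%N.
Variables (t h : R).
Hypothesis h_gt0 : 0 < h.
Implicit Types (psi dpsi : R -> R) (x : 'rV[R]_n).

Definition smoothed_df psi t h x : R := n%:R^-1 * \sum_i psi ((t - x 0 i) / h).

Let nR_gt0 : 0 < n%:R :> R. Proof. by rewrite ltr0n. Qed.

Let smooth_arg i : smooth (fun x : 'rV[R]_n => (t - x 0 i) / h).
Proof.
have -> : (fun x : 'rV[R]_n => (t - x 0 i) / h) =
    fun x => t / h + (- h^-1) * x 0 i by apply: funext => x; ring.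
by apply: smoothD; [exact: smooth_cst|apply: smoothZ => k; exact: class_C_coord].
Qed.

Lemma smooth_logistic_df : smooth (smoothed_df logistic t h).
Proof.
apply: smoothZ => k; apply: class_C_sum => i.
exact: (class_C_comp is_derive_logistic (smooth_arg i k)).
Qed.

Lemma smooth_logistic_bump_df : smooth (smoothed_df logistic_bump t h).
Proof.
apply: smoothZ => k; apply: class_C_sum => i.
have C := class_C_comp is_derive_logistic (smooth_arg i k).
have -> : (fun x : 'rV[R]_n => logistic_bump ((t - x 0 i) / h)) =
    fun x => logistic ((t - x 0 i) / h) +
      (-1) * (logistic ((t - x 0 i) / h) * logistic ((t - x 0 i) / h)).
  by apply: funext => x; rewrite /logistic_bump mulN1r.
apply: class_CD => //; apply: class_CM; first exact: class_C_cst.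
exact: class_CM.
Qed.

Lemma smoothed_df_itv psi (a b : R) x :
  (forall y, a <= psi y <= b) -> a <= smoothed_df psi t h x <= b.
Proof.
move=> ab; rewrite /smoothed_df.
have S c : \sum_(i < n) c = n%:R * c :> R.
  by rewrite sumr_const card_ord mulr_natl.
rewrite ler_pdivlMl // ler_pdivrMl // -!S.
by apply/andP; split; apply: ler_sum => i _;
  have /andP[] := ab ((t - x 0 i) / h).
Qed.

Lemma partial_smoothed_df psi dpsi i x :
    (forall y : R, is_derive y (1 : R) psi (dpsi y)) ->
  partial i (smoothed_df psi t h) x = - (dpsi ((t - x 0 i) / h) / (n%:R * h)).
Proof.
move=> dp; rewrite /partial.
have da j : is_derive x (delta_mx 0 i) (fun x : 'rV[R]_n => (t - x 0 j) / h)
    (- ((i == j)%:R / h)).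
  have dc := is_derive_coord i j x.
  have -> : (fun x : 'rV[R]_n => (t - x 0 j) / h) =
      fun x => t / h + (- h^-1) * x 0 j by apply: funext => z; ring.
  apply: is_derive_eq; rewrite /GRing.scale /=.
  by rewrite ?add0r ?addr0 mulNr mulrC.
have dpj j : is_derive x (delta_mx 0 i) (fun x : 'rV[R]_n => psi ((t - x 0 j) / h))
    (- ((i == j)%:R / h) * dpsi ((t - x 0 j) / h)).
  exact: (is_derive_comp (dp _) (da j)).
have ds := is_derive_sum (fun j => dpj j).
have [_ e] := is_deriveZ n%:R^-1 ds.
have -> : smoothed_df psi t h =
    n%:R^-1 *: (\sum_(j < n) (fun x : 'rV[R]_n => psi ((t - x 0 j) / h))).
  by apply: funext => z; rewrite /smoothed_df /GRing.scale /= fct_sumE.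
rewrite e (bigD1 i) //= big1 => [|j /negPf ji]; last first.
  by rewrite eq_sym ji mul0r oppr0 mul0r.
by rewrite eqxx addr0 /GRing.scale /=; field; rewrite !lt0r_neq0.
Qed.

(** Each coordinate occurs in a single summand, so its squared partial derivative carries 1 / n^2;
    one factor 1 / n is spent on averaging the bumps. *)
Lemma grad_sq_smoothed_df psi dpsi x :
    (forall y : R, is_derive y (1 : R) psi (dpsi y)) ->
    (forall y, dpsi y ^+ 2 <= logistic_bump y) ->
  grad_sq (smoothed_df psi t h) x <=
    (n%:R * h ^+ 2)^-1 * smoothed_df logistic_bump t h x.
Proof.
move=> dp dle; rewrite /grad_sq /smoothed_df mulrA mulr_sumr.
apply: ler_sum => i _; rewrite (partial_smoothed_df _ _ dp) sqrrN.
rewrite expr_div_n mulrC.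
have -> : (n%:R * h ^+ 2)^-1 * n%:R^-1 = ((n%:R * h) ^+ 2)^-1 :> R.
  by field; rewrite !lt0r_neq0.
by rewrite ler_pM2l ?dle // invr_gt0 exprn_gt0 // mulr_gt0.
Qed.

End Averages.

(** * Concentration of the smoothed empirical distribution function *)

Section Concentration.
Context {R : realType} {n : nat}.
Variables (mu : probability (euclid R n) R) (s t h : R).
Hypotheses (n_gt0 : (0 < n)%N) (s_gt0 : 0 < s) (h_gt0 : 0 < h) (lsi : LSI mu s).

Lemma bounded_measurable_logistic_df t' :
  bounded_measurable (smoothed_df logistic t' h : euclid R n -> R).
Proof.
apply: (@smooth_bounded_measurable _ _ _ 1); first exact: smooth_logistic_df.
move=> x; have /andP[l0 l1] : 0 <= smoothed_df logistic t' h x <= 1.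
  by apply: smoothed_df_itv => // y; rewrite !ltW ?logistic_gt0 ?logistic_lt1.
by rewrite ger0_norm.
Qed.

Lemma logistic_bump_df_itv t' (x : 'rV[R]_n) :
  0 <= smoothed_df logistic_bump t' h x <= 1.
Proof.
apply: smoothed_df_itv => // y.
by rewrite logistic_bump_ge0 logistic_bump_le1.
Qed.

Lemma bounded_measurable_logistic_bump_df t' :
  bounded_measurable (smoothed_df logistic_bump t' h : euclid R n -> R).
Proof.
apply: (@smooth_bounded_measurable _ _ _ 1); first exact: smooth_logistic_bump_df.
by move=> x; have /andP[l0 l1] := logistic_bump_df_itv t' x; rewrite ger0_norm.
Qed.

(** Chernoff's bound at the single parameter 1 / (2 s a), a = 1 / (n h^2), allowed by
    [self_bounded_laplace]. The sign [e] is moved into the kernel, so both tails are treated at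
    once. *)
Lemma logistic_df_tail (e rho : R) : e ^+ 2 = 1 ->
  (mu [set x | (rho <= e * (smoothed_df logistic t h x
                 - \int[mu]_z smoothed_df logistic t h z))%R] <=
   (expR (- ((rho - \int[mu]_z smoothed_df logistic_bump t h z)
             * (n%:R * h ^+ 2 / (2 * s)))))%:E)%E.
Proof.
move=> e2; pose G : 'rV[R]_n -> R := smoothed_df logistic t h.
pose B : 'rV[R]_n -> R := smoothed_df logistic_bump t h.
rewrite -/G -/B.
have nR0 : 0 < n%:R :> R by rewrite ltr0n.
set a := (n%:R * h ^+ 2)^-1.
have a0 : 0 < a by rewrite invr_gt0 mulr_gt0 // exprn_gt0.
have l01 (x : 'rV[R]_n) : 0 <= G x <= 1.
  by apply: smoothed_df_itv => // y; rewrite !ltW ?logistic_gt0 ?logistic_lt1.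
have ne : `|e| = 1.
  have : `|e| ^+ 2 = 1 by rewrite -normrX e2 normr1.
  by move=> /eqP; rewrite sqrf_eq1 => /orP[/eqP//|/eqP h']; have := normr_ge0 e; lra.
have sG : smooth G by exact: smooth_logistic_df.
have sB : smooth B by exact: smooth_logistic_bump_df.
have bG := bounded_measurable_logistic_df t.
have bB := bounded_measurable_logistic_bump_df t.
have seG : smooth (fun x => e * G x) by exact: smoothZ.
have eG1 x : `|e * G x| <= 1.
  by rewrite normrM ne mul1r; have /andP[p q] := l01 x; rewrite ger0_norm.
have deG x : grad_sq (fun x => e * G x) x <= a * B x.
  have -> : (fun x => e * G x) = smoothed_df (fun y => e * logistic y) t h.
    apply: funext => z; rewrite /G /smoothed_df mulrCA; congr (_ * _).
    by rewrite mulr_sumr.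
  apply: (grad_sq_smoothed_df n_gt0 t h_gt0 (dpsi := fun y => e * logistic_bump y)) => // y.
    have d := is_derive_logistic y.
    apply: is_derive_eq; rewrite /logistic_bump /GRing.scale /=; ring.
  rewrite exprMn e2 mul1r.
  by have := logistic_bump_ge0 y; have := logistic_bump_le1 y; nra.
have dB x : grad_sq B x <= a * B x.
  apply: (grad_sq_smoothed_df n_gt0 t h_gt0
    (dpsi := fun y => (1 - 2 * logistic y) * logistic_bump y)) => // y.
    exact: is_derive_logistic_bump.
  have b0 := logistic_bump_ge0 y; have b1 := logistic_bump_le1 y.
  have l0 := logistic_gt0 y; have l1 := logistic_lt1 y.
  have c1 : (1 - 2 * logistic y) ^+ 2 <= 1 by nra.
  rewrite exprMn; apply: le_trans (_ : 1 * logistic_bump y ^+ 2 <= _).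
    by rewrite ler_wpM2r // sqr_ge0.
  nra.
have lap := self_bounded_laplace s_gt0 a0 lsi seG sB eG1
  (logistic_bump_df_itv t) deG dB.
set k := n%:R * h ^+ 2 / (2 * s).
have kE : k = (2 * (s * a))^-1.
  by rewrite /k /a; field; rewrite !lt0r_neq0.
have k0 : 0 < k by rewrite kE invr_gt0 !mulr_gt0.
set g := \int[mu]_z G z; set b := \int[mu]_z B z.
have bf : bounded_measurable ((fun x => k * e * G x + - (k * e * g)) : euclid R n -> R).
  by apply: bounded_measurableD;
    [exact: bounded_measurableZ|exact: bounded_measurable_cst].
have := exponential_markov mu (k * rho) bf.
have -> : [set x | k * rho <= k * e * G x + - (k * e * g)] =
          [set x | rho <= e * (G x - g)].
  apply: eq_set => x.
  have -> : k * e * G x + - (k * e * g) = k * (e * (G x - g)) by ring.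
  by rewrite ler_pM2l.
move=> /le_trans; apply; rewrite lee_fin.
have -> : \int[mu]_x expR (k * e * G x + - (k * e * g)) =
    expR (- (k * e * g)) * \int[mu]_x expR (e * G x / (2 * (s * a))).
  rewrite -meanZ; last first.
    have bh : bounded_measurable ((fun x => (2 * (s * a))^-1 * (e * G x)) : euclid R n -> R).
      by apply: bounded_measurableZ; exact: bounded_measurableZ.
    apply: bounded_measurable_expR.
    by move: bh; under eq_fun do rewrite mulrC.
  apply: eq_Rintegral => x _; rewrite -expRD -kE; congr expR; ring.
rewrite mulrA -expRD.
apply: le_trans (ler_wpM2l (expR_ge0 _) lap) _.
rewrite -expRD ler_expR -kE meanZ // -/g -/b; lra.
Qed.

End Concentration.

(** * The logistic kernel as a mixture of half-line indicators *)

Section Layers.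
Context {R : realType}.

(** The sum is the minimum of N and the integer part of z. The second and fourth clauses pin it to N
    when z >= N, which carries the induction. *)
Lemma sum_threshold (z : R) (N : nat) : 0 <= z ->
  [/\ \sum_(1 <= j < N.+1) (j%:R <= z)%R%:R <= z,
      \sum_(1 <= j < N.+1) (j%:R <= z)%R%:R <= N%:R :> R,
      z < N.+1%:R -> z <= \sum_(1 <= j < N.+1) (j%:R <= z)%R%:R + 1 &
      N%:R <= z -> N%:R <= \sum_(1 <= j < N.+1) (j%:R <= z)%R%:R :> R].
Proof.
move=> z0; elim: N => [|N [IH1 IH2 IH3 IH4]].
  by rewrite big_geq //; split => //; lra.
rewrite big_nat_recr //=; set S := \sum_(1 <= j < N.+1) _ in IH1 IH2 IH3 IH4 *.
have NS : N.+1%:R = N%:R + 1 :> R by rewrite -natr1.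
have NSS : N.+2%:R = N%:R + 2 :> R by rewrite -!natr1; ring.
rewrite NSS; rewrite NS in IH3 *.
have [le|lt] := leP (N%:R + 1) z.
  have := IH4 ltac:(lra) => h; rewrite /=; split; lra.
have := IH3 lt => h; rewrite /=; split; lra.
Qed.

(** The j/N-quantile of the logistic law, meant for 0 < j < N. *)
Definition logit_layer (N j : nat) : R := ln (j%:R / N%:R / (1 - j%:R / N%:R)).

Lemma logit_layerP N j y : (0 < j < N)%N ->
  (logit_layer N j <= y) = (j%:R <= N%:R * logistic y).
Proof.
move=> /andP[j0 jN]; have N0 : 0 < N%:R :> R by rewrite ltr0n (ltn_trans j0).
rewrite -ler_logistic logistic_logit; last first.
  by rewrite ltr_pdivrMr // mul1r ltr_nat jN andbT divr_gt0 // ltr0n.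
by rewrite ler_pdivrMr // mulrC.
Qed.

(** The odds p / (1 - p) lie in [1/9, 9], and ln w <= w - 1 turns 9 into 8: this is the origin of
    the shift by 8 h. *)
Lemma logit_layer_abs_le8 N j : (0 < N)%N ->
  1/10 <= (j%:R / N%:R : R) <= 9/10 -> `|logit_layer N j| <= 8.
Proof.
move=> N0; rewrite /logit_layer; set p : R := _ / _ => /andP[p1 p9].
have q0 : 0 < 1 - p by lra.
have e0 : 0 < p / (1 - p) by rewrite divr_gt0 //; lra.
have H (w : R) : 0 < w -> w <= 9 -> ln w <= 8.
  move=> w0 w9; have := @le_ln1Dx _ (w - 1).
  by rewrite [1 + _](_ : _ = w); [move=> /(_ ltac:(lra)); lra|ring].
rewrite ler_norml; apply/andP; split.
  rewrite lerNl -lnV ?posrE //; apply: H; first by rewrite invr_gt0.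
  by rewrite invf_div ler_pdivrMr; lra.
by apply: H => //; rewrite ler_pdivrMr //; lra.
Qed.

Lemma logistic_layers N y : (0 < N)%N ->
  \sum_(1 <= j < N) (logit_layer N j <= y)%R%:R <= N%:R * logistic y <=
  \sum_(1 <= j < N) (logit_layer N j <= y)%R%:R + 1.
Proof.
case: N => // N _.
have -> : \sum_(1 <= j < N.+1) (logit_layer N.+1 j <= y)%R%:R =
    \sum_(1 <= j < N.+1) (j%:R <= N.+1%:R * logistic y)%R%:R :> R.
  by rewrite big_nat [RHS]big_nat; apply: eq_bigr => j jN; rewrite logit_layerP.
have NR : 0 < N.+1%:R :> R by rewrite ltr0n.
have z0 : 0 <= N.+1%:R * logistic y by rewrite mulr_ge0 ?ltW ?logistic_gt0.
have [-> _ -> //] := sum_threshold N z0.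
by rewrite -[ltRHS]mulr1 ltr_pM2l ?logistic_lt1.
Qed.

Context {n : nat}.
Hypothesis n_gt0 : (0 < n)%N.
Implicit Type x : 'rV[R]_n.

Lemma empirical_dfE x t : empirical_df x t = n%:R^-1 * \sum_(i < n) (x 0 i <= t)%R%:R.
Proof.
rewrite /empirical_df mulrC; congr (_ * _).
rewrite -sum1_card natr_sum big_mkcond /=; apply: eq_bigr => i _.
by rewrite inE; case: (x 0 i <= t).
Qed.

Lemma empirical_df_itv x t : 0 <= empirical_df x t <= 1.
Proof.
rewrite /empirical_df divr_ge0 ?ler0n //= ler_pdivrMr ?ltr0n // mul1r ler_nat.
by rewrite -[leqRHS]card_ord max_card.
Qed.

Lemma le_empirical_df x t u : t <= u -> empirical_df x t <= empirical_df x u.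
Proof.
move=> tu; rewrite !empirical_dfE ler_pM2l ?invr_gt0 ?ltr0n //.
apply: ler_sum => i _; have [xt|_] := leP (x 0 i) t; last exact: ler0n.
by rewrite (le_trans xt tu).
Qed.

(* Layer-cake decomposition of the logistic kernel along its [j/N]-quantiles. *)
Lemma smoothed_df_layers x t h N : 0 < h -> (0 < N)%N ->
  N%:R^-1 * \sum_(1 <= j < N) empirical_df x (t - h * logit_layer N j) <=
    smoothed_df logistic t h x <=
  N%:R^-1 * \sum_(1 <= j < N) empirical_df x (t - h * logit_layer N j) + N%:R^-1.
Proof.
move=> h0 N0; have NR : 0 < N%:R :> R by rewrite ltr0n.
have nR : 0 < n%:R :> R by rewrite ltr0n.
have -> : \sum_(1 <= j < N) empirical_df x (t - h * logit_layer N j) =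
    n%:R^-1 * \sum_(i < n)
      \sum_(1 <= j < N) (logit_layer N j <= (t - x 0 i) / h)%R%:R.
  rewrite exchange_big /= mulr_sumr; apply: eq_bigr => j _.
  rewrite empirical_dfE; congr (_ * _); apply: eq_bigr => i _; congr (_%:R).
  by rewrite ler_pdivlMr // mulrC lerBrDr lerBrDl addrC.
rewrite /smoothed_df; set S := \sum_(i < n) _; set L := \sum_(i < n) _.
have SL : S <= N%:R * L <= S + n%:R.
  have -> : S + n%:R = \sum_(i < n)
      (\sum_(1 <= j < N) (logit_layer N j <= (t - x 0 i) / h)%R%:R + 1).
    by rewrite big_split /= sumr_const card_ord.
  rewrite /L mulr_sumr; apply/andP; split; apply: ler_sum => i _;
    by have /andP[] := logistic_layers ((t - x 0 i) / h) N0.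
have /andP[h1 h2] := SL.
have -> : n%:R^-1 * L = N%:R^-1 * (n%:R^-1 * (N%:R * L)).
  by field; rewrite !lt0r_neq0.
have -> : N%:R^-1 * (n%:R^-1 * S) + N%:R^-1 = N%:R^-1 * (n%:R^-1 * (S + n%:R)).
  by field; rewrite !lt0r_neq0.
by rewrite !ler_pM2l ?invr_gt0 // h1.
Qed.

End Layers.

(** * Means of smoothed functions and persistence of a discrepancy *)

Section Smoothing.
Context {R : realType} {n : nat}.
Variables (mu : probability (euclid R n) R) (M : R).
Hypothesis n_gt0 : (0 < n)%N.

Definition mean_empirical_df t : R := \int[mu]_x empirical_df x t.

Local Notation F := mean_empirical_df.

Hypothesis F_lipschitz : forall t u, t <= u -> F u - F t <= M * (u - t).

Lemma bounded_measurable_empirical_df t :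
  bounded_measurable ((fun x => empirical_df x t) : euclid R n -> R).
Proof.
under eq_fun do rewrite empirical_dfE.
apply/bounded_measurableZ/bounded_measurable_sum => i.
split; last first.
  by exists 1 => x; rewrite ger0_norm ?ler0n // lern1 leq_b1.
have mc : measurable_fun setT ((fun x : 'rV[R]_n => x 0 i) : euclid R n -> R).
  by apply: continuous_measurable_euclid; exact: coord_continuous.
have -> : (fun x : euclid R n => ((x : 'rV[R]_n) 0 i <= t)%R%:R : R) =
    \1_[set x : euclid R n | (x : 'rV[R]_n) 0 i <= t].
  by apply: funext => x; rewrite indicE mem_setE.
apply: measurable_indic.
have -> : [set x : euclid R n | (x : 'rV[R]_n) 0 i <= t] =
    setT `&` (fun x : euclid R n => (x : 'rV[R]_n) 0 i) @^-1` `]-oo, t]%classic.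
  by apply/seteqP; split => x /=; rewrite in_itv //= => -[].
by apply: mc => //; exact: measurable_itv.
Qed.

Lemma le_mean_empirical_df t u : t <= u -> F t <= F u.
Proof.
move=> tu; apply: le_mean; [exact: bounded_measurable_empirical_df..|].
by move=> x; exact: le_empirical_df.
Qed.

Lemma mean_empirical_df_itv t : 0 <= F t <= 1.
Proof.
rewrite -{1}(mean_cst mu 0) -(mean_cst mu 1); apply/andP; split;
  apply: le_mean => [||x]; try exact: bounded_measurable_empirical_df;
  try exact: bounded_measurable_cst; by have /andP[] := empirical_df_itv n_gt0 x t.
Qed.

Lemma mean_smoothed_df_layers t h N : 0 < h -> (0 < N)%N ->
  N%:R^-1 * \sum_(1 <= j < N) F (t - h * logit_layer N j) <=
    \int[mu]_x smoothed_df logistic t h x <=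
  N%:R^-1 * \sum_(1 <= j < N) F (t - h * logit_layer N j) + N%:R^-1.
Proof.
move=> h0 N0.
have bs : bounded_measurable
    ((fun x => N%:R^-1 * \sum_(1 <= j < N) empirical_df x (t - h * logit_layer N j))
       : euclid R n -> R).
  apply/bounded_measurableZ/bounded_measurable_sum => j.
  exact: bounded_measurable_empirical_df.
have -> : N%:R^-1 * \sum_(1 <= j < N) F (t - h * logit_layer N j) =
    \int[mu]_x (N%:R^-1 * \sum_(1 <= j < N) empirical_df x (t - h * logit_layer N j)).
  rewrite meanZ; last first.
    by apply: bounded_measurable_sum => j; exact: bounded_measurable_empirical_df.
  rewrite mean_sum // => j; exact: bounded_measurable_empirical_df.
rewrite -[X in _ + X](mean_cst mu) -meanD //; last exact: bounded_measurable_cst.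
have bl := bounded_measurable_logistic_df h n_gt0 t.
apply/andP; split; apply: le_mean => //.
- by move=> x; have /andP[] := smoothed_df_layers n_gt0 x t h0 N0.
- by apply: bounded_measurableD => //; exact: bounded_measurable_cst.
- by move=> x; have /andP[] := smoothed_df_layers n_gt0 x t h0 N0.
Qed.

(** Averaging translates of F keeps its Lipschitz constant; the layers give this up to 1 / N, and N
    is arbitrary. *)
Lemma mean_smoothed_df_lipschitz t u h : 0 < h -> t <= u ->
  \int[mu]_x smoothed_df logistic u h x <=
    \int[mu]_x smoothed_df logistic t h x + M * (u - t).
Proof.
move=> h0 tu; apply/ler_addgt0Pr => e e0.
have [N N0 Ne] : exists2 N, (0 < N)%N & N%:R^-1 <= e.
  exists (Num.bound e^-1).+1 => //.
  have bd : e^-1 < (Num.bound e^-1)%:R by apply: archi_boundP; rewrite invr_ge0 ltW.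
  rewrite -[leRHS]invrK lef_pV2 ?posrE ?invr_gt0 ?ltr0n //.
  by apply: ltW (lt_le_trans bd _); rewrite ler_nat.
have NR : 0 < N%:R :> R by rewrite ltr0n.
have /andP[_ h1] := mean_smoothed_df_layers u h0 N0.
have /andP[h2 _] := mean_smoothed_df_layers t h0 N0.
have M0 : 0 <= M * (u - t).
  by apply: le_trans (F_lipschitz tu); rewrite subr_ge0 le_mean_empirical_df.
suff : N%:R^-1 * \sum_(1 <= j < N) F (u - h * logit_layer N j) <=
    N%:R^-1 * \sum_(1 <= j < N) F (t - h * logit_layer N j) + M * (u - t) by lra.
rewrite -lerBlDl -mulrBr -sumrB ler_pdivrMl //.
apply: le_trans (_ : \sum_(1 <= j < N) (M * (u - t)) <= _).
  apply: ler_sum => j _; set c := h * _.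
  have := @F_lipschitz (t - c) (u - c) ltac:(lra).
  by rewrite [X in M * X](_ : _ = u - t); last by ring.
rewrite sumr_const_nat -[leLHS]mulr_natl ler_wpM2r // ler_nat; exact: leq_subr.
Qed.

Lemma mean_bump_df_le t h : 0 < h ->
  \int[mu]_x smoothed_df logistic_bump t h x <= 2 * (M * h).
Proof.
move=> h0.
have bl := bounded_measurable_logistic_df h n_gt0.
have lip := @mean_smoothed_df_lipschitz t (t + h) h h0 ltac:(lra).
apply: le_trans (_ : \int[mu]_x (2 * (smoothed_df logistic (t + h) h x
    + - smoothed_df logistic t h x)) <= _).
  apply: le_mean => [||x].
  - exact: bounded_measurable_logistic_bump_df.
  - by apply: bounded_measurableZ; apply: bounded_measurableD => //;
      exact: bounded_measurableN.
  - rewrite /smoothed_df -mulrBr mulrCA ler_pM2l ?invr_gt0 ?ltr0n //.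
    rewrite -sumrB mulr_sumr; apply: ler_sum => i _.
    have -> : (t + h - x 0 i) / h = (t - x 0 i) / h + 1.
      by field; rewrite lt0r_neq0.
    exact: logistic_bump_le_increment.
have bN := bounded_measurableN (bl t).
rewrite meanZ; last exact: bounded_measurableD.
rewrite meanD // meanN //; lra.
Qed.

(* A discrepancy close to the supremum [D] at [t] persists on an interval of
   length comparable to [D / M], which carries most of the logistic kernel
   centred at [t + 8 e h]; off that interval the discrepancy is at least
   [- D]. *)
Lemma smoothed_discrepancy (x : 'rV[R]_n) (e t h D : R) :
    e = 1 \/ e = -1 -> 0 < h -> 0 < D -> 16 * (M * h) <= D / 10 ->
    (forall u, `|empirical_df x u - F u| <= D) ->
    9/10 * D <= e * (empirical_df x t - F t) ->
  4/10 * D <= e * (smoothed_df logistic (t + 8 * e * h) h x -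
                   \int[mu]_y smoothed_df logistic (t + 8 * e * h) h y).
Proof.
move=> e1 h0 D0 hM xD xt; set t1 := t + 8 * e * h.
pose Delta u := e * (empirical_df x u - F u).
have Delta_ge u : - D <= Delta u.
  have := xD u; rewrite /Delta ler_norml => /andP[d1 d2].
  by case: e1 => ->; lra.
(* The point lies on the side [e] of t, at distance at most 16 h: monotonicity of the empirical
   function costs nothing, and F moves by at most 16 M h <= D / 10. *)
have core u : `|u| <= 8 -> 8/10 * D <= Delta (t1 - h * u).
  rewrite ler_norml => /andP[u1 u2].
  have hu1 : h * u <= h * 8 by rewrite ler_pM2l.
  have hu2 : h * - 8 <= h * u by rewrite ler_pM2l.
  have hu3 : 0 <= M.
    have : 0 <= M * (1 - 0).
      by apply: le_trans (F_lipschitz ler01); rewrite subr_ge0 le_mean_empirical_df.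
    by lra.
  rewrite /Delta /t1; case: e1 xt => ->; rewrite ?mulr1 => xt.
    have le : t <= t + 8 * h - h * u by lra.
    have := F_lipschitz le; have := le_empirical_df n_gt0 x le.
    have : M * (t + 8 * h - h * u - t) <= M * (16 * h) by rewrite ler_wpM2l //; lra.
    by lra.
  have le : t + 8 * -1 * h - h * u <= t by lra.
  have := F_lipschitz le; have := le_empirical_df n_gt0 x le.
  have : M * (t - (t + 8 * -1 * h - h * u)) <= M * (16 * h).
    by rewrite ler_wpM2l //; lra.
  by lra.
(* A multiple of ten layers puts the levels 1/10 and 9/10 at the indices q and 9 q; the bound on 1 /
   N pays for the layer error. *)
have [q q0 qD] : exists2 q, (0 < q)%N & (10 * q)%:R^-1 <= 4/100 * D.
  exists (Num.bound (4/100 * D)^-1).+1 => //.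
  have D0' : 0 < 4/100 * D by lra.
  have bd : (4/100 * D)^-1 < (Num.bound (4/100 * D)^-1)%:R.
    by apply: archi_boundP; rewrite invr_ge0 ltW.
  rewrite -[leRHS]invrK lef_pV2 ?posrE ?invr_gt0 ?ltr0n ?muln_gt0 //.
  apply: ltW (lt_le_trans bd _); rewrite ler_nat.
  by apply: leq_trans (leqnSn _) _; rewrite leq_pmull.
set N := (10 * q)%N in qD.
have N0 : (0 < N)%N by rewrite muln_gt0.
have NR : 0 < N%:R :> R by rewrite ltr0n.
have qR : 0 < q%:R :> R by rewrite ltr0n.
have NE : N%:R = 10 * q%:R :> R by rewrite natrM.
have /andP[g1 g2] := smoothed_df_layers n_gt0 x t1 h0 N0.
have /andP[g3 g4] := mean_smoothed_df_layers t1 h0 N0.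
(* Eight tenths of the layers contribute 8/10 D each and the two extreme tenths at least - D: 64/10
   - 2 = 44/10. *)
have sum_ge : 44/10 * D * q%:R <= \sum_(1 <= j < N) Delta (t1 - h * logit_layer N j).
  rewrite (@big_cat_nat _ _ _ q) ?leq_pmull //=.
  rewrite [X in _ + X](@big_cat_nat _ _ _ (9 * q)%N) ?leq_pmull ?leq_pmul2r //=.
  have s1 : - D * q%:R <= \sum_(1 <= j < q) Delta (t1 - h * logit_layer N j).
    apply: le_trans (_ : \sum_(1 <= j < q) (- D) <= _); last exact: ler_sum.
    rewrite sumr_const_nat -[leRHS]mulr_natr !mulNr lerN2 ler_pM2l //.
    by rewrite ler_nat leq_subr.
  have s3 : - D * q%:R <= \sum_(9 * q <= j < N) Delta (t1 - h * logit_layer N j).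
    apply: le_trans (_ : \sum_(9 * q <= j < N) (- D) <= _); last exact: ler_sum.
    by rewrite sumr_const_nat -mulnBl mul1n mulr_natr.
  have s2 : 64/10 * D * q%:R <= \sum_(q <= j < 9 * q) Delta (t1 - h * logit_layer N j).
    apply: le_trans (_ : \sum_(q <= j < 9 * q) (8/10 * D) <= _).
      rewrite sumr_const_nat (_ : (9 * q - q = 8 * q)%N); last first.
        by rewrite -[X in (_ - X)%N]mul1n -mulnBl.
      by rewrite -[leRHS]mulr_natr natrM; lra.
    rewrite big_nat [leRHS]big_nat; apply: ler_sum => j /andP[j1 j2].
    apply/core/logit_layer_abs_le8 => //.
    have j1' : q%:R <= j%:R :> R by rewrite ler_nat.
    have j2' : j%:R <= 9 * q%:R :> R by rewrite -natrM ler_nat ltnW.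
    by rewrite ler_pdivlMr // ler_pdivrMr // NE; lra.
  move: s1 s2 s3. clear; lra.
have : 44/100 * D <= N%:R^-1 * \sum_(1 <= j < N) Delta (t1 - h * logit_layer N j).
  by rewrite ler_pdivlMl // NE; lra.
have -> : \sum_(1 <= j < N) Delta (t1 - h * logit_layer N j) =
    e * (\sum_(1 <= j < N) empirical_df x (t1 - h * logit_layer N j) -
         \sum_(1 <= j < N) F (t1 - h * logit_layer N j)).
  by rewrite -sumrB mulr_sumr.
move: g1 g2 g3 g4; set g := smoothed_df _ _ _ _; set gm := \int[mu]_y _.
set S1 := \sum_(1 <= j < N) _; set S2 := \sum_(1 <= j < N) _.
by move=> ? ? ? ?; case: e1 => ->; lra.
Qed.

End Smoothing.

(** * Monotone convergence to one *)

Section BoundedMonotoneConvergence.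
Context d (T : measurableType d) (R : realType) (mu : probability T R).

(** Supplies the limits of F at both infinities, hence the existence of its quantiles. *)
Lemma mean_eventually_one (g : nat -> T -> R) (p : R) : p < 1 ->
    (forall k, bounded_measurable (g k)) ->
    (forall k x, 0 <= g k x) ->
    (forall k l x, (k <= l)%N -> g k x <= g l x) ->
    (forall x, exists k, forall l, (k <= l)%N -> g l x = 1) ->
  exists k, p < \int[mu]_x g k x.
Proof.
move=> p1 bg g0 ndg g1; apply: contrapT => /forallNP H.
have H' k : (\int[mu]_x (g k x)%:E <= p%:E)%E.
  by rewrite -EFin_mean // lee_fin leNgt; apply/negP; exact: H.
have mg k : measurable_fun setT (fun x => (g k x)%:E).
  by apply/measurable_EFinP; case: (bg k).
have nn k x : setT x -> (0 <= (g k x)%:E)%E by rewrite lee_fin.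
have nd x : setT x -> {homo (fun k => (g k x)%:E) : k l / (k <= l)%N >-> (k <= l)%E}.
  by move=> _ k l kl; rewrite lee_fin ndg.
have L : (\int[mu]_x (limn (fun k => (g k x)%:E)) <= p%:E)%E.
  have c := @cvg_monotone_convergence _ _ _ mu _ measurableT _ mg nn nd.
  rewrite -(cvg_lim _ c) //; apply: lime_le; last by near=> k; exact: H'.
  by apply/cvg_ex; eexists; exact: c.
have E x : limn (fun k => (g k x)%:E) = 1%E.
  apply: cvg_lim => //; have [k kP] := g1 x.
  apply: cvg_near_cst; exists k => // l /= kl.
  by rewrite kP.
move: L; under eq_integral do rewrite E.
rewrite -[X in (X <= _)%E](@EFin_mean _ _ _ mu (fun=> 1)); last exact: bounded_measurable_cst.
by rewrite mean_cst lee_fin leNgt p1.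
Unshelve. all: by end_near.
Qed.

End BoundedMonotoneConvergence.

(** * The Kolmogorov distance of functions with values in [0, 1] *)

Section KolmogorovDistance.
Context {R : realType}.
Implicit Types F G : R -> R.

Lemma kolmogorov_dist_ge F G t :
  (forall u, 0 <= F u <= 1) -> (forall u, 0 <= G u <= 1) ->
  `|F t - G t| <= kolmogorov_dist F G.
Proof.
move=> F1 G1; apply: ub_le_sup; last by exists t.
exists 1 => _ [u _ <-]; have /andP[? ?] := F1 u; have /andP[? ?] := G1 u.
by rewrite ler_norml; lra.
Qed.

Lemma kolmogorov_dist_itv F G :
  (forall u, 0 <= F u <= 1) -> (forall u, 0 <= G u <= 1) ->
  0 <= kolmogorov_dist F G <= 1.
Proof.
move=> F1 G1; apply/andP; split.
  by apply: le_trans (kolmogorov_dist_ge 0 F1 G1).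
apply: ge_sup => [|_ [u _ <-]]; first by exists `|F 0 - G 0|, 0.
have /andP[? ?] := F1 u; have /andP[? ?] := G1 u.
by rewrite ler_norml; lra.
Qed.

Lemma kolmogorov_dist_gtP F G (y : R) :
    (forall u, 0 <= F u <= 1) -> (forall u, 0 <= G u <= 1) ->
  y < kolmogorov_dist F G <-> exists t, y < `|F t - G t|.
Proof.
move=> F1 G1; split => [h|[t]]; last first.
  by move=> /lt_le_trans; apply; exact: kolmogorov_dist_ge.
have hs : has_sup (range (fun t => `|F t - G t|)).
  split; first by exists `|F 0 - G 0|, 0.
  exists 1 => _ [u _ <-]; have /andP[? ?] := F1 u; have /andP[? ?] := G1 u.
  by rewrite ler_norml; lra.
have e0 : 0 < kolmogorov_dist F G - y by rewrite subr_gt0.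
have [_ [t _ <-]] := sup_adherent e0 hs.
by rewrite -/(kolmogorov_dist F G) subKr => ?; exists t.
Qed.

End KolmogorovDistance.

(** * Quantiles of F, measurability of the distance and the tail bound *)

Section Tail.
Context {R : realType} {n : nat}.
Variables (mu : probability (euclid R n) R) (M : R).
Hypotheses (n_gt0 : (0 < n)%N) (M_gt0 : 0 < M).

Local Notation F := (mean_empirical_df mu).

Hypothesis F_lipschitz : forall t u, t <= u -> F u - F t <= M * (u - t).

Let F_itv t : 0 <= F t <= 1. Proof. exact: mean_empirical_df_itv. Qed.

Let emp_itv (x : 'rV[R]_n) t : 0 <= empirical_df x t <= 1.
Proof. exact: empirical_df_itv. Qed.

Let empirical_df_far (x : 'rV[R]_n) :
  exists k : nat, forall l : nat, (k <= l)%N ->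
    empirical_df x l%:R = 1 /\ empirical_df x (- l%:R) = 0.
Proof.
pose m : R := \sum_i `|x 0 i| + 1.
have m0 : 0 <= m by rewrite addr_ge0 // sumr_ge0.
have xm i : `|x 0 i| < m.
  rewrite /m (bigD1 i) //= ltr_pwDr // lerDl; exact: sumr_ge0.
exists (Num.bound m) => l kl.
have ml : m < l%:R.
  by apply: lt_le_trans (archi_boundP m0) _; rewrite ler_nat.
have nR : n%:R != 0 :> R by rewrite pnatr_eq0 -lt0n.
rewrite !empirical_dfE; split.
  rewrite (eq_bigr (fun=> 1)) ?sumr_const ?card_ord ?mulVf // => i _.
  have := xm i; rewrite ltr_norml => /andP[? ?].
  by rewrite (_ : (_ <= _)%R) //; lra.
rewrite big1 ?mulr0 // => i _; have := xm i; rewrite ltr_norml => /andP[? ?].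
by rewrite leNgt (_ : (_ < _)%R) //; lra.
Qed.

Lemma mean_empirical_df_surj p : 0 < p < 1 -> exists t, F t = p.
Proof.
move=> /andP[p0 p1].
have bF := bounded_measurable_empirical_df.
have [k pk] : exists k : nat, p < F k%:R.
  apply: (@mean_eventually_one _ _ _ mu (fun k x => empirical_df x k%:R)) => //.
  - by move=> k x; have /andP[] := emp_itv x k%:R.
  - by move=> k l x kl; apply: le_empirical_df => //; rewrite ler_nat.
  - move=> x; have [k kP] := empirical_df_far x; exists k => l kl.
    by have [] := kP l kl.
have [l pl] : exists l : nat, F (- l%:R) < p.
  have bN t : bounded_measurable ((fun x => 1 + - empirical_df x t) : euclid R n -> R).
    by apply: bounded_measurableD; [exact: bounded_measurable_cst|
      exact/bounded_measurableN/bF].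
  have [||||l] := @mean_eventually_one _ _ _ mu
      (fun k x => 1 + - empirical_df x (- k%:R)) (1 - p) _ (fun k => bN _).
  - by lra.
  - by move=> k0 x; have /andP[] := emp_itv x (- k0%:R); lra.
  - move=> a b x ab; rewrite lerD2l lerN2; apply: le_empirical_df => //.
    by rewrite lerN2 ler_nat.
  - move=> x; have [k0 kP] := empirical_df_far x; exists k0 => j kj.
    by have [_ ->] := kP j kj; rewrite subr0.
  rewrite meanD ?meanN; [|exact: bF|exact: bounded_measurable_cst|
    exact/bounded_measurableN/bF].
  rewrite mean_cst -/(F _) => ?; exists l; lra.
have kl : - l%:R <= k%:R :> R.
  by have := ler0n R l; have := ler0n R k; lra.
have cF : {within `[- l%:R, k%:R], continuous F}.
  apply: continuous_subspaceT => t; apply/cvgrPdist_lt => e e0.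
  near=> u.
  have tu : M * `|t - u| < e.
    rewrite -ltr_pdivlMl // mulrC; near: u.
    by apply: cvgr_dist_lt; rewrite ?divr_gt0.
  have [h|h] := leP t u.
    have := F_lipschitz h; have := le_mean_empirical_df mu n_gt0 h.
    move: tu; rewrite ler0_norm ?subr_le0 // => tu ? ?.
    by rewrite ltr_norml; lra.
  have h' := ltW h.
  have := F_lipschitz h'; have := le_mean_empirical_df mu n_gt0 h'.
  move: tu; rewrite ger0_norm ?subr_ge0 // => tu ? ?.
  by rewrite ltr_norml; lra.
have FF : F (- l%:R) <= F k%:R by exact: le_mean_empirical_df.
have [|t _ <-] := IVT kl cF (v := p); last by exists t.
by rewrite min_l // max_r // !ltW.
Unshelve. all: by end_near.
Qed.

(* Between consecutive quantiles [F] varies by at most [1/m] and both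
   functions are monotone, so a large discrepancy shows at one of the
   [m - 1] quantiles. *)
Lemma discrepancy_at_quantile (q : nat -> R) (m : nat) (x : 'rV[R]_n) (D : R) :
    (0 < m)%N ->
    (forall j, (0 < j < m)%N -> F (q j) = j%:R / m%:R) ->
    0 < D -> m%:R^-1 <= D / 20 -> D <= kolmogorov_dist (empirical_df x) F ->
  exists j (e : R), [/\ (0 < j < m)%N, e = 1 \/ e = -1 &
    9/10 * kolmogorov_dist (empirical_df x) F <=
      e * (empirical_df x (q j) - F (q j))].
Proof.
move=> m0 qF D0 mD; set K := kolmogorov_dist _ _ => DK.
have mR : 0 < m%:R :> R by rewrite ltr0n.
(* The supremum need not be attained: 5/100 of [K] is given up here, and 5/100 more to the spacing 1
   / m <= D / 20. *)
have [t tK] : exists t, 95/100 * K < `|empirical_df x t - F t|.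
  by apply/kolmogorov_dist_gtP => //; rewrite -/K; lra.
have /andP[F0 F1] := F_itv t; have /andP[E0 E1] := emp_itv x t.
pose k := Num.truncn (m%:R * F t).
have /andP[k1 k2] : k%:R <= m%:R * F t < k.+1%:R.
  by apply: truncn_itv; rewrite mulr_ge0 // ltW.
have k1' : k%:R / m%:R <= F t by rewrite ler_pdivrMr // mulrC.
have k2' : F t <= k%:R / m%:R + m%:R^-1.
  rewrite -[X in _ + X]mul1r -mulrDl natr1 ler_pdivlMr // mulrC; exact: ltW.
move: tK; rewrite ltr_normr => /orP[tK|tK].
(* Positive discrepancy: move right to the next quantile. It is an interior one, since F t >= 1 - 1
   / m would leave no room for the discrepancy. *)
- have km : (0 < k.+1 < m)%N.
    rewrite /= ltnNge; apply/negP => mk.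
    have : m%:R <= k.+1%:R :> R by rewrite ler_nat.
    rewrite -natr1 => mk'.
    have : 1 <= k%:R / m%:R + m%:R^-1 :> R.
      by rewrite -[X in _ + X]mul1r -mulrDl ler_pdivlMr // mul1r.
    by lra.
  have Fq : F (q k.+1) = k%:R / m%:R + m%:R^-1.
    by rewrite qF // -natr1 mulrDl mul1r.
  exists k.+1, 1; split => //; first by left.
  have tq : t <= q k.+1.
    rewrite leNgt; apply/negP => h.
    have := le_mean_empirical_df mu n_gt0 (ltW h); rewrite Fq => h'.
    move: k2; rewrite ltNge => /negP; apply.
    have : k.+1%:R / m%:R <= F t by rewrite -natr1 mulrDl mul1r.
    by rewrite ler_pdivrMr // mulrC.
  have := le_empirical_df n_gt0 x tq; rewrite Fq; lra.
(* Negative discrepancy: move left. The inequality on the left must be strict, as F (q j) = F t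
   would not place q j before t; hence the predecessor when m F t is an integer. *)
- have [j /andP[j1 j2]] : exists j : nat, j%:R < m%:R * F t <= j.+1%:R.
    have [kE|kE] := eqVneq k%:R (m%:R * F t); last first.
      by exists k; rewrite lt_neqAle kE k1 ltW.
    have : (0 : R) < k%:R by rewrite kE mulr_gt0 //; lra.
    rewrite ltr0n => k0; exists k.-1.
    by rewrite prednK // -kE lexx andbT ltr_nat prednK.
  have j1' : j%:R / m%:R < F t by rewrite ltr_pdivrMr // mulrC.
  have j2' : F t <= j%:R / m%:R + m%:R^-1.
    by rewrite -[X in _ + X]mul1r -mulrDl natr1 ler_pdivlMr // mulrC.
  have jm : (0 < j < m)%N.
    apply/andP; split.
      rewrite lt0n; apply/negP => /eqP j0.
      by move: j2'; rewrite j0 mul0r add0r; lra.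
    rewrite -(ltr_nat R) ltNge; apply/negP => h.
    have : 1 <= j%:R / m%:R :> R by rewrite ler_pdivlMr // mul1r.
    by lra.
  have Fq : F (q j) = j%:R / m%:R by rewrite qF.
  exists j, (-1); split => //; first by right.
  have qt : q j <= t.
    rewrite leNgt; apply/negP => h.
    by have := le_mean_empirical_df mu n_gt0 (ltW h); rewrite Fq; lra.
  by have := le_empirical_df n_gt0 x qt; rewrite Fq; lra.
Qed.

(** The supremum may be taken over rationals: a discrepancy exceeding y by a gap still exceeds y
    within gap / M, to the right if positive and to the left if negative. *)
Lemma measurable_kolmogorov_dist :
  measurable_fun setT
    ((fun x => kolmogorov_dist (empirical_df x) F) : euclid R n -> R).
Proof.
apply: (measurability _ (RGenOInfty.measurableE R)) => _ [_ [y ->] <-].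
rewrite setTI.
have -> : (fun x : euclid R n => kolmogorov_dist (empirical_df x) F) @^-1` `]y, +oo[ =
    \bigcup_(q : rat) [set x : euclid R n | y < `|empirical_df x (ratr q) - F (ratr q)|].
  apply/seteqP; split => x /=; rewrite in_itv /= andbT; last first.
    move=> [q _ yq]; apply/kolmogorov_dist_gtP => //.
    by exists (ratr q).
  move=> /(kolmogorov_dist_gtP _ (emp_itv x) F_itv)[t].
  rewrite ltr_normr => /orP[ty|ty].
    set d := (empirical_df x t - F t - y) / M.
    have d0 : 0 < d by rewrite divr_gt0 // subr_gt0.
    have [q] := @rat_in_itvoo R t (t + d) ltac:(lra).
    rewrite in_itv /= => /andP[tq qd]; exists q => //=.
    rewrite ltr_normr; apply/orP; left.
    have tq' := ltW tq.
    have := F_lipschitz tq'; have := le_empirical_df n_gt0 x tq'.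
    have : M * (ratr q - t) < M * d by rewrite ltr_pM2l //; move: tq qd; clear; lra.
    rewrite [M * d]mulrC divfK ?lt0r_neq0 //; lra.
  set d := (- (empirical_df x t - F t) - y) / M.
  have d0 : 0 < d by rewrite divr_gt0 // subr_gt0.
  have [q] := @rat_in_itvoo R (t - d) t ltac:(lra).
  rewrite in_itv /= => /andP[tq qd]; exists q => //=.
  rewrite ltr_normr; apply/orP; right.
  have qd' := ltW qd.
  have := F_lipschitz qd'; have := le_empirical_df n_gt0 x qd'.
  have : M * (t - ratr q) < M * d by rewrite ltr_pM2l //; move: tq qd; clear; lra.
  rewrite [M * d]mulrC divfK ?lt0r_neq0 //; lra.
apply: bigcupT_measurable_rat => q.
have mf : measurable_fun setT
    ((fun x => `|empirical_df x (ratr q) - F (ratr q)|) : euclid R n -> R).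
  apply: measurableT_comp => //; apply: measurable_funB => //.
  by case: (bounded_measurable_empirical_df (R := R) (n := n) (ratr q)).
have -> : [set x : euclid R n | y < `|empirical_df x (ratr q) - F (ratr q)|] =
    setT `&` (fun x : euclid R n => `|empirical_df x (ratr q) - F (ratr q)|)
      @^-1` `]y, +oo[%classic.
  by apply/seteqP; split => x /=; rewrite in_itv /= andbT // => -[].
by apply: mf => //; exact: measurable_itv.
Qed.

Variable s : R.
Hypotheses (s_gt0 : 0 < s) (lsi : LSI mu s).

Lemma measurable_kolmogorov_dist_ge (r : R) :
  measurable [set x : euclid R n | r <= kolmogorov_dist (empirical_df x) F].
Proof.
have -> : [set x : euclid R n | r <= kolmogorov_dist (empirical_df x) F] =
    setT `&` (fun x : euclid R n => kolmogorov_dist (empirical_df x) F)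
      @^-1` `[r, +oo[%classic.
  by apply/seteqP; split => x /=; rewrite in_itv /= andbT // => -[].
by apply: measurable_kolmogorov_dist => //; exact: measurable_itv.
Qed.

Lemma union_tail (r : R) : 0 < r -> r <= 1 ->
  (mu [set x : euclid R n | (r <= kolmogorov_dist (empirical_df x) F)%R] <=
    (40 / r * expR (- (3 / 80 ^+ 3 * (r ^+ 3 * n%:R / (M ^+ 2 * s)))))%:E)%E.
Proof.
(* With m = p + 1 the spacing 1 / m is at most r / 20, while the m - 1 = p interior quantiles number
   at most 20 / r; two signs make 40 / r. *)
move=> r0 r1; pose p := Num.truncn (20 / r); pose m := p.+1.
have /andP[p1 p2] : p%:R <= 20 / r < m%:R.
  by apply: truncn_itv; rewrite divr_ge0 // ltW.
have m0 : (0 < m)%N by [].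
have mR : 0 < m%:R :> R by rewrite ltr0n.
have /choice[q qF] : forall j : nat, exists t, (0 < j < m)%N -> F t = j%:R / m%:R.
  move=> j; case: (boolP (0 < j < m)%N) => [/andP[j0 jm]|_]; last by exists 0.
  have [|t tj] := @mean_empirical_df_surj (j%:R / m%:R); last by exists t.
  by rewrite ltr_pdivrMr // mul1r ltr_nat jm andbT divr_gt0 // ltr0n.
(* The largest width with 16 M h <= r / 10, as [smoothed_discrepancy] requires. *)
pose h := r / (160 * M).
have h0 : 0 < h by rewrite divr_gt0 // mulr_gt0.
have Mh : M * h = r / 160 by rewrite /h; field; rewrite lt0r_neq0.
have nR : 0 < n%:R :> R by rewrite ltr0n.
pose G t : 'rV[R]_n -> R := smoothed_df logistic t h.
pose E (e : R) (j : nat) : set (euclid R n) :=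
  [set x | 4/10 * r <= e * (G (q j.+1 + 8 * e * h) x
              - \int[mu]_y G (q j.+1 + 8 * e * h) y)].
set b := expR _.
have mE e j : measurable (E e j).
  have bG := bounded_measurable_logistic_df h n_gt0 (q j.+1 + 8 * e * h).
  have bE : bounded_measurable ((fun x => e * (G (q j.+1 + 8 * e * h) x
      + - \int[mu]_y G (q j.+1 + 8 * e * h) y)) : euclid R n -> R).
    by apply/bounded_measurableZ/bounded_measurableD => //;
      exact: bounded_measurable_cst.
  have -> : E e j = setT `&` (fun x : euclid R n => e * (G (q j.+1 + 8 * e * h) x
      + - \int[mu]_y G (q j.+1 + 8 * e * h) y)) @^-1` `[4/10 * r, +oo[%classic.
    by apply/seteqP; split => x /=; rewrite in_itv /= andbT // => -[].
  by apply: (proj1 bE) => //; exact: measurable_itv.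
have Eb e j : e = 1 \/ e = -1 -> (mu (E e j) <= b%:E)%E.
  move=> e1; have e2 : e ^+ 2 = 1 by case: e1 => ->; ring.
  have := logistic_df_tail (q j.+1 + 8 * e * h) n_gt0 s_gt0 h0 lsi (4/10 * r) e2.
  move=> /le_trans; apply; rewrite lee_fin ler_expR lerN2.
  have := mean_bump_df_le n_gt0 F_lipschitz (q j.+1 + 8 * e * h) h0.
  set B := \int[mu]_x _; rewrite Mh => hB.
  (* The mean of the bump is at most r / 80, so at least 3/10 r remains of 4/10 r; the constant is
     10 * 2 * 160^2 = 80^3. *)
  have -> : 3 / 80 ^+ 3 * (r ^+ 3 * n%:R / (M ^+ 2 * s)) =
      3/10 * r * (n%:R * h ^+ 2 / (2 * s)).
    by rewrite /h; field; rewrite !lt0r_neq0.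
  rewrite ler_pM2r; first by lra.
  by apply: divr_gt0; apply: mulr_gt0 => //; exact: exprn_gt0.
have mp : m%:R^-1 <= r / 20.
  by rewrite -[leRHS]invrK lef_pV2 ?posrE ?invr_gt0 ?divr_gt0 // invf_div ltW.
pose EE j := E 1 j `|` E (-1) j.
have sub : [set x : euclid R n | r <= kolmogorov_dist (empirical_df x) F] `<=`
    \big[setU/set0]_(j < p) EE j.
  move=> x /= rx.
  have [j' [e [jm e1]]] := discrepancy_at_quantile m0 qF r0 mp rx.
  case: j' jm => [//|j] jm jK.
  rewrite -bigcup_mkord; exists j => //=.
  set D := kolmogorov_dist (empirical_df x) F in rx jK.
  have D0 : 0 < D by exact: lt_le_trans rx.
  have hM : 16 * (M * h) <= D / 10 by rewrite Mh; lra.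
  have DD u : `|empirical_df x u - F u| <= D by exact: kolmogorov_dist_ge.
  have := smoothed_discrepancy n_gt0 F_lipschitz e1 h0 D0 hM DD jK.
  rewrite -!/(G _) => hD; have {}hD := le_trans (_ : 4/10 * r <= 4/10 * D) hD.
  by case: e1 hD => -> hD; [left|right]; apply: hD; lra.
have mEE j : `I_p j -> measurable (EE j) by move=> _; exact: measurableU.
apply: le_trans (content_subadditive mu mEE (measurable_kolmogorov_dist_ge r) sub) _.
apply: le_trans (_ : (\sum_(j < p) (2 * b)%:E <= _)%E).
  apply: lee_sum => j _; apply: le_trans (measureU2 _ _ _) _ => //.
  have -> : (2 * b)%:E = (b%:E + b%:E)%E by rewrite -EFinD; congr (_%:E); ring.
  by apply: leeD; apply: Eb; [left|right].
rewrite sumEFin lee_fin sumr_const card_ord -[leLHS]mulr_natr.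
have b0 : 0 <= b by exact: expR_ge0.
by have := ler_wpM2l b0 p1; rewrite /=; lra.
Qed.

(* The number of quantiles is absorbed in the exponent: [mu _ <= 1] gives
   [mu _ ^ 4 <= mu _]. *)
Lemma kolmogorov_dist_tail (r : R) : 0 < r ->
  (mu [set x : euclid R n | (r <= kolmogorov_dist (empirical_df x) F)%R] <=
    (4 / r * expR (- (3 / (4 * 80 ^+ 3)) * (r ^+ 3 * n%:R / (M ^+ 2 * s))))%:E)%E.
Proof.
move=> r0; have [r1|r1] := leP r 1; last first.
  rewrite (_ : [set x | _] = set0) ?measure0.
    by rewrite lee_fin mulr_ge0 ?expR_ge0 // divr_ge0 // ltW.
  apply/seteqP; split => x //= rx.
  by have /andP[_] := kolmogorov_dist_itv (emp_itv x) F_itv; lra.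
have := union_tail r0 r1; set y := r ^+ 3 * n%:R / (M ^+ 2 * s).
set A := [set x | _].
have fA : mu A \is a fin_num by exact: fin_num_measure (measurable_kolmogorov_dist_ge r).
have mA1 : (mu A <= 1)%E by exact: probability_le1 (measurable_kolmogorov_dist_ge r).
have mA0 : (0 <= mu A)%E by exact: measure_ge0.
move: mA1 mA0; rewrite -(fineK fA); set a := fine (mu A); rewrite !lee_fin => a1 a0 h.
set b := expR (- (3 / (4 * 80 ^+ 3)) * y).
have b4 : expR (- (3 / 80 ^+ 3 * y)) = b ^+ 4.
  by rewrite /b -expRM_natl; congr expR; rewrite /=; lra.
have b0 : 0 <= b by exact: expR_ge0.
have c0 : 0 <= 4 / r * b by rewrite mulr_ge0 // divr_ge0 // ltW.
rewrite -(@ler_pXn2r _ 4) ?nnegrE //.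
have a4 : a ^+ 4 <= a.
  by rewrite -[leRHS]expr1 ler_wiXn2l.
apply: le_trans a4 (le_trans h _); rewrite b4 exprMn ler_wpM2r ?exprn_ge0 //.
have i1 : 1 <= r^-1 by rewrite invf_ge1.
(* What remains is 40 / r <= (4 / r)^4, which holds as r <= 1. *)
rewrite expr_div_n ler_pdivrMr // mulrAC ler_pdivlMr ?exprn_gt0 //.
have r3 : r ^+ 3 <= 1 by rewrite exprn_ile1 // ltW.
have := ler_wpM2r (ltW r0) r3; rewrite mul1r -exprSr; lra.
Qed.

End Tail.

(** * Transfer of the hypotheses to the law of the vector *)

Lemma LSI_weaken {R : realType} {n : nat} (mu : probability (euclid R n) R)
  (s s' : R) : s <= s' -> LSI mu s -> LSI mu s'.
Proof.
move=> ss lsi g bg sg; apply: le_trans (lsi g bg sg) _.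
apply: lee_wpmul2r; last by rewrite lee_fin ler_pM2l.
by apply: integral_ge0 => x _; rewrite lee_fin sumr_ge0 // => i _; exact: sqr_ge0.
Qed.

Lemma density_lipschitz {R : realType} (F : R -> R) (M : R) :
    has_density_bounded_by F M ->
  forall t u, t <= u -> F u - F t <= M * (u - t).
Proof.
move=> [f [mf fM Ff]] t u tu.
have mfE D : measurable_fun D (fun x => (f x)%:E).
  by apply/measurable_EFinP; exact: measurable_funTS.
have split_u : `]-oo, u]%classic = `]-oo, t]%classic `|` `]t, u]%classic :> set R.
  apply/seteqP; split => x /=; rewrite !in_itv /=.
    by have [xt|tx] := leP x t; [left|right].
  by move=> [/le_trans->//|/andP[]].
have Fu : ((F u)%:E = (F t)%:E + \int[lebesgue_measure]_(x in `]t, u]) (f x)%:E)%E.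
  rewrite !Ff split_u ge0_integral_setU //=.
  - exact: mfE.
  - by move=> x _; rewrite lee_fin; case/andP: (fM x).
  - apply/disj_setPS => x /= []; rewrite !in_itv /= => xt /andP[tx _].
    by move: xt; rewrite leNgt tx.
have : (\int[lebesgue_measure]_(x in `]t, u]) (f x)%:E <= (M * (u - t))%:E)%E.
  apply: le_trans (_ : \int[lebesgue_measure]_(x in `]t, u]) M%:E <= _)%E.
    apply: ge0_le_integral => //=.
    - by move=> x _; rewrite lee_fin; case/andP: (fM x).
    - exact: mfE.
    - by move=> x _; rewrite lee_fin; case/andP: (fM x).
  rewrite integral_cst //= lebesgue_measure_itv /= lte_fin.
  case: ltP => [_|ut]; first by rewrite -EFinD -EFinM.
  by rewrite mule0 lee_fin (_ : u = t) ?subrr ?mulr0 //; apply/eqP; rewrite eq_le ut.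
move: Fu; set I := (\int[_]_(_ in _) _)%E => Fu IM.
have If : I \is a fin_num.
  rewrite ge0_fin_numE; first exact: le_lt_trans IM (ltry _).
  by apply: integral_ge0 => x _; rewrite lee_fin; case/andP: (fM x).
move: IM Fu; rewrite -(fineK If) lee_fin -EFinD => IM [->].
by rewrite addrAC subrr add0r.
Qed.

Lemma mean_df_distribution {R : realType} {n : nat} d (T : measurableType d)
    (P : probability T R) (X : {RV P >-> euclid R n}) :
  mean_df X = mean_empirical_df (distribution P X).
Proof.
apply: funext => t; rewrite /mean_df /mean_empirical_df /Rintegral unlock.
rewrite ge0_integral_distribution //.
  apply/measurable_EFinP.
  by case: (bounded_measurable_empirical_df (R := R) (n := n) t).
by move=> x; rewrite lee_fin divr_ge0.
Qed.

(** * Bounds on the expected distance *)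

Section Expectation.
Context {R : realType} {n : nat}.
Variables (mu : probability (euclid R n) R) (M : R).
Hypotheses (n_gt0 : (0 < n)%N) (M_ge0 : 0 <= M).

Local Notation F := (mean_empirical_df mu).

Hypothesis F_lipschitz : forall t u, t <= u -> F u - F t <= M * (u - t).

Lemma lipschitz_weaken (M' : R) : M <= M' ->
  forall t u, t <= u -> F u - F t <= M' * (u - t).
Proof.
move=> MM t u tu; apply: le_trans (F_lipschitz tu) _.
by rewrite ler_wpM2r // subr_ge0.
Qed.

Lemma bounded_measurable_kolmogorov_dist : bounded_measurable
  ((fun x => kolmogorov_dist (empirical_df x) F) : euclid R n -> R).
Proof.
split.
  have M1 : 0 < M + 1 by rewrite ltr_wpDl.
  have MM1 : M <= M + 1 by rewrite lerDl.
  exact: (measurable_kolmogorov_dist n_gt0 M1 (lipschitz_weaken MM1)).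
exists 1 => x; have /andP[k0 k1] := kolmogorov_dist_itv
  (empirical_df_itv n_gt0 x) (mean_empirical_df_itv mu n_gt0).
by rewrite ger0_norm.
Qed.

(** The distance is at most 1, hence at most r plus the indicator that it reaches r. The enlarged
    constants M' and s' are there for the case M sigma = 0, where the tail bound needs positive
    ones. *)
Lemma mean_kolmogorov_dist_le (s M' s' r : R) :
    M <= M' -> 0 < M' -> s <= s' -> 0 < s' -> LSI mu s -> 0 < r ->
  \int[mu]_x kolmogorov_dist (empirical_df x) F <=
    r + 4 / r * expR (- (3 / (4 * 80 ^+ 3)) * (r ^+ 3 * n%:R / (M' ^+ 2 * s'))).
Proof.
move=> MM M0 ss s0 lsi r0.
have FM := lipschitz_weaken MM.
have := kolmogorov_dist_tail n_gt0 M0 FM s0 (LSI_weaken ss lsi) r0.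
set A := [set x | _] => tail.
have mA : measurable A := measurable_kolmogorov_dist_ge n_gt0 M0 FM r.
rewrite -lee_fin EFinD; apply: le_trans (leeD2l _ tail).
have bA : bounded_measurable (\1_A : euclid R n -> R).
  split; first exact: measurable_indic.
  by exists 1 => x; rewrite indicE ger0_norm ?ler0n // lern1 leq_b1.
have -> : mu A = (\int[mu]_x (\1_A x : R))%:E.
  by rewrite EFin_mean // integral_indic // setIT.
rewrite -EFinD lee_fin -[X in X + _](mean_cst mu) -meanD //; last exact: bounded_measurable_cst.
apply: le_mean => [||x].
- exact: bounded_measurable_kolmogorov_dist.
- by apply: bounded_measurableD => //; exact: bounded_measurable_cst.
have /andP[k0 k1] := kolmogorov_dist_itv
  (empirical_df_itv n_gt0 x) (mean_empirical_df_itv mu n_gt0).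
rewrite indicE; have [|] := boolP (x \in A).
  by move=> _ /=; lra.
rewrite notin_setE /A /= => /negP; rewrite -ltNge => /ltW; lra.
Qed.

(** The hypotheses survive replacing M and sigma by M + z and sigma + z; as z tends to 0 the product
    of the new constants does too, and the exponential beats 4 / r for every fixed r. *)
Lemma mean_kolmogorov_dist_degenerate (sigma : R) : 0 <= sigma ->
    M * sigma = 0 -> LSI mu (sigma ^+ 2) ->
  \int[mu]_x kolmogorov_dist (empirical_df x) F <= 0.
Proof.
move=> sigma0 Ms lsi; have M0 := M_ge0; apply/ler_addgt0Pr => e e0; rewrite add0r.
set c : R := 3 / (4 * 80 ^+ 3).
have c0 : 0 < c by rewrite /c divr_gt0 // mulr_gt0 // exprn_gt0.
set r := e / 2; have r0 : 0 < r by rewrite divr_gt0.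
(* Chosen so that V <= dl makes the exponent at least 4 / r^2; as e^(-x) <= 1 / x, the tail term is
   then at most r. *)
set dl := c * r ^+ 5 / 4.
have dl0 : 0 < dl by rewrite divr_gt0 // mulr_gt0 // exprn_gt0.
set Q := M + sigma + 1; have Q0 : 0 < Q by rewrite /Q; lra.
pose k := Num.min 1 dl.
have k0 : 0 < k by rewrite lt_min ltr01.
have [k1 kd] : k <= 1 /\ k <= dl by split; rewrite ge_min lexx ?orbT.
(* Since M sigma = 0, (M + z)(sigma + z) = z (M + sigma + z) <= z Q = k, and k^2 <= dl because k is
   below both 1 and dl. *)
pose z := k / Q.
have z0 : 0 < z by rewrite divr_gt0.
have zQ : z * Q = k by rewrite /z divfK // lt0r_neq0.
have z1 : z <= 1.
  by rewrite /z ler_pdivrMr // mul1r (le_trans k1) // /Q; lra.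
set V := (M + z) ^+ 2 * (sigma + z) ^+ 2.
have V0 : 0 < V.
  by rewrite /V mulr_gt0 // exprn_gt0 //; lra.
have VE : (M + z) * (sigma + z) = z * (M + sigma + z) + M * sigma by ring.
have Vk : V <= dl.
  have : (M + z) * (sigma + z) <= k.
    by rewrite VE Ms addr0 -zQ ler_pM2l // /Q; lra.
  have p0 : 0 <= (M + z) * (sigma + z) by rewrite mulr_ge0 //; lra.
  rewrite /V -exprMn; set w := _ * _ in p0 * => wk.
  have : w * w <= k * 1 by apply: ler_pM => //; lra.
  by rewrite mulr1 -expr2 => /le_trans; apply.
have sz : sigma ^+ 2 <= (sigma + z) ^+ 2 by rewrite lerXn2r ?nnegrE; lra.
have sz0 : 0 < (sigma + z) ^+ 2 by rewrite exprn_gt0 //; lra.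
have := mean_kolmogorov_dist_le (M' := M + z) _ _ sz sz0 lsi r0.
move=> /(_ ltac:(lra) ltac:(lra)) /le_trans; apply.
rewrite -/c -/V; set x := c * (r ^+ 3 * n%:R / V).
have nR : 1 <= n%:R :> R by rewrite ler1n.
have x0 : 0 < x.
  by rewrite /x mulr_gt0 // divr_gt0 // mulr_gt0 ?exprn_gt0 //; lra.
have -> : - c * (r ^+ 3 * n%:R / V) = - x by rewrite mulNr.
have ex : expR (- x) <= x^-1.
  rewrite expRN lef_pV2 ?posrE ?expR_gt0 //.
  by have := expR_ge1Dx x; lra.
have xi : x^-1 <= r ^+ 2 / 4.
  rewrite -[leRHS]invrK lef_pV2 ?posrE ?invr_gt0 ?divr_gt0 ?exprn_gt0 //.
  rewrite /x invf_div mulrA ler_pdivlMr //.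
  apply: le_trans (_ : 4 / r ^+ 2 * dl <= _).
    by rewrite ler_pM2l // divr_gt0 // exprn_gt0.
  have -> : 4 / r ^+ 2 * dl = c * r ^+ 3 * 1.
    by rewrite /dl; field; rewrite lt0r_neq0.
  rewrite [leRHS](_ : _ = c * r ^+ 3 * n%:R); last by ring.
  by rewrite ler_pM2l // mulr_gt0 // exprn_gt0.
apply: le_trans (_ : r + 4 / r * (r ^+ 2 / 4) <= _).
  by rewrite lerD2l ler_pM2l ?divr_gt0 // (le_trans ex).
have -> : 4 / r * (r ^+ 2 / 4) = r by field; rewrite lt0r_neq0.
by rewrite /r; lra.
Qed.

End Expectation.

(* With [r = K beta l], [l^3 = ln (1 + 1 / beta)] and [c K^3 >= 2], the
   exponential is at most [(1 + 1 / beta)^-2]. *)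
Lemma rate_choice {R : realType} (c beta : R) : 0 < c -> 0 < beta ->
  exists2 r, 0 < r &
    r + 4 / r * expR (- c * (r / beta) ^+ 3) <=
      (1 + 2 / c + 4) * beta * (ln (1 + 1 / beta)) `^ (1 / 3).
Proof.
move=> c0 b0; set L := ln (1 + 1 / beta); set l := L `^ (1 / 3).
have ib0 : 0 < 1 / beta by rewrite divr_gt0.
have L0 : 0 < L by apply: ln_gt0; lra.
have l0 : 0 < l by rewrite powR_gt0.
have l3 : l ^+ 3 = L.
  rewrite /l -(powR_mulrn 3 (powR_ge0 _ _)) -powRrM divfK ?pnatr_eq0 //.
  by rewrite powRr1 // ltW.
(* Needed for large beta: as (1 + 1 / beta)^-1 = beta / (1 + beta), it leads to the bound beta l for
   this factor, whose square cancels the 1 / r in front of the exponential. *)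
have Lge : (1 + beta)^-1 <= L.
  have := @le_ln1Dx _ (- (1 + beta)^-1).
  have i1 : (1 + beta)^-1 < 1 by rewrite invf_lt1; lra.
  move=> /(_ ltac:(lra)).
  have -> : 1 - (1 + beta)^-1 = (1 + 1 / beta)^-1.
    by field; rewrite !lt0r_neq0 //; lra.
  by rewrite lnV ?posrE -/L; lra.
have lge : (1 + beta)^-1 <= l.
  have q0 : 0 <= (1 + beta)^-1 by rewrite invr_ge0; lra.
  have q1 : (1 + beta)^-1 <= 1 by rewrite invf_le1; lra.
  have l0' := ltW l0.
  rewrite -(@ler_pXn2r _ 3) ?nnegrE // l3.
  by apply: le_trans Lge; rewrite -[leRHS]expr1 ler_wiXn2l.
set K := 1 + 2 / c.
have K1 : 1 <= K by rewrite /K lerDl divr_ge0 ?ltW.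
have cK : 2 <= c * K ^+ 3.
  have h : K <= K ^+ 3 by rewrite -[leLHS]expr1 ler_weXn2l.
  have h2 : 2 <= c * K by rewrite /K mulrDr mulr1 mulrCA mulfV ?lt0r_neq0 //; lra.
  by apply: le_trans h2 _; rewrite ler_pM2l.
have K0 : 0 < K by lra.
have r0 : 0 < K * beta * l by rewrite !mulr_gt0.
exists (K * beta * l) => //.
have -> : (K * beta * l / beta) ^+ 3 = K ^+ 3 * L.
  by rewrite -l3; field; rewrite lt0r_neq0.
have ex : expR (- c * (K ^+ 3 * L)) <= ((1 + 1 / beta)^-1) ^+ 2.
  apply: le_trans (_ : expR (- (2 * L)) <= _).
    by rewrite ler_expR mulNr lerN2 mulrA ler_pM2r.
  rewrite expRN exprVn lef_pV2 ?posrE ?exprn_gt0 ?expR_gt0 ?addr_gt0 //.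
  by rewrite expRM_natl /L lnK ?posrE ?addr_gt0.
rewrite -/l [leRHS](_ : _ = K * beta * l + 4 * beta * l); last by rewrite /K; ring.
rewrite lerD2l; apply: le_trans (_ : 4 / (K * beta * l) * (beta * l) ^+ 2 <= _).
  rewrite ler_pM2l ?divr_gt0 // (le_trans ex) //.
  have i0 : 0 <= (1 + 1 / beta)^-1 by rewrite ltW // invr_gt0 addr_gt0.
  have bl0 : 0 <= beta * l by rewrite ltW // mulr_gt0.
  rewrite lerXn2r //.
  have -> : (1 + 1 / beta)^-1 = beta * (1 + beta)^-1.
    by field; rewrite !lt0r_neq0 //; lra.
  by rewrite ler_pM2l.
have -> : 4 / (K * beta * l) * (beta * l) ^+ 2 = 4 * beta * l * K^-1.
  by field; rewrite !lt0r_neq0.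
by rewrite ger_pMr ?invf_le1 // !mulr_gt0.
Qed.

(** * Assembly, with the case beta = 0 treated apart *)

Theorem theorem1p2 (R : realType) :
  exists c C : R, [/\ 0 < c, 0 < C &
    forall (n : nat) (sigma M : R)
      (d : measure_display) (T : measurableType d) (P : probability T R)
      (X : {RV P >-> euclid R n}),
    (1 <= n)%N -> 0 <= sigma ->
    LSI (distribution P X) (sigma ^+ 2) ->
    has_density_bounded_by (mean_df X) M ->
    let beta := (M * sigma) `^ (2 / 3) / n%:R `^ (1 / 3) in
    let dist := fun w : T => kolmogorov_dist (empirical_df (X w)) (mean_df X) in
    (forall r : R, 0 < r ->
       (P [set w | (r <= dist w)%R] <= (4 / r * expR (- c * (r / beta) ^+ 3))%:E)%E)
    /\ ('E_P[dist] <= (C * beta * (ln (1 + 1 / beta)) `^ (1 / 3))%:E)%E].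
Proof.
set c : R := 3 / (4 * 80 ^+ 3).
have c0 : 0 < c by rewrite /c divr_gt0 // mulr_gt0 // exprn_gt0.
exists c, (1 + 2 / c + 4); split => // [|n sigma M d T P X n0 sigma0 lsi dens].
  have : 0 < 2 / c by rewrite divr_gt0.
  by lra.
move=> beta dist.
have M0 : 0 <= M.
  by case: dens => f [_ /(_ 0)/andP[f0 fM] _]; exact: le_trans f0 fM.
have lip := density_lipschitz dens.
have distE w : dist w = kolmogorov_dist (empirical_df (X w))
    (mean_empirical_df (distribution P X)) by rewrite /dist mean_df_distribution.
rewrite mean_df_distribution in lip.
set mu : probability (euclid R n) R := distribution P X in lip distE lsi *.
have EE : ('E_P[dist] = (\int[mu]_x kolmogorov_dist (empirical_df x)
    (mean_empirical_df mu))%R%:E)%E.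
  have bk := bounded_measurable_kolmogorov_dist n0 M0 lip.
  rewrite EFin_mean // unlock ge0_integral_distribution //.
  - by apply: eq_integral => w _; rewrite /= distE.
  - by apply/measurable_EFinP; case: bk.
  - move=> x; rewrite lee_fin.
    by have /andP[] := kolmogorov_dist_itv
      (empirical_df_itv n0 x) (mean_empirical_df_itv mu n0).
have PE r : P [set w | r <= dist w] = mu [set x | r <=
    kolmogorov_dist (empirical_df x) (mean_empirical_df mu)].
  by congr (P _); apply: eq_set => w; rewrite distE.
have nR : 0 < n%:R :> R by rewrite ltr0n.
have [Ms|Ms] := eqVneq (M * sigma) 0.
  have b0 : beta = 0.
    by rewrite /beta Ms powR0 ?mul0r // mulf_neq0 ?invr_eq0 ?pnatr_eq0.
  split => [r r0|].
    (* Division by zero gives r / 0 = 0, so the exponential is 1 and the claim is P <= 4 / r: a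
       probability is at most 1, and the event is empty once r exceeds 4. *)
    rewrite b0 invr0 mulr0 expr0n /= mulr0 expR0 mulr1 PE.
    have [r4|r4] := leP r 4.
      apply: le_trans (probability_le1 _ _) _.
        have M1 : 0 < M + 1 by lra.
        have MM1 : M <= M + 1 by lra.
        exact: (measurable_kolmogorov_dist_ge n0 M1 (lipschitz_weaken lip MM1)).
      by rewrite lee_fin ler_pdivlMr // mul1r.
    rewrite (_ : [set x | _] = set0) ?measure0 ?lee_fin ?divr_ge0 ?ltW //.
    apply/seteqP; split => x //= rx.
    have /andP[_] := kolmogorov_dist_itv
      (empirical_df_itv n0 x) (mean_empirical_df_itv mu n0); lra.
  rewrite EE b0 mulr0 mul0r lee_fin.
  exact: (mean_kolmogorov_dist_degenerate n0 M0 lip sigma0 Ms lsi).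
have Mpos : 0 < M.
  by rewrite lt0r M0 andbT; apply: contra_neq Ms => ->; rewrite mul0r.
have spos : 0 < sigma.
  by rewrite lt0r sigma0 andbT; apply: contra_neq Ms => ->; rewrite mulr0.
have b0 : 0 < beta by rewrite divr_gt0 ?powR_gt0 // mulr_gt0.
have b3 : beta ^+ 3 = M ^+ 2 * sigma ^+ 2 / n%:R.
  have cube (a p : R) : (a `^ (p / 3)) ^+ 3 = a `^ p.
    by rewrite -(powR_mulrn 3 (powR_ge0 _ _)) -powRrM divfK ?pnatr_eq0.
  rewrite /beta expr_div_n !cube (powR_mulrn 2 (mulr_ge0 M0 sigma0)) exprMn.
  by rewrite powRr1 // ltW.
have s2 : 0 < sigma ^+ 2 by rewrite exprn_gt0.
have yE r : (r / beta) ^+ 3 = r ^+ 3 * n%:R / (M ^+ 2 * sigma ^+ 2).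
  by rewrite expr_div_n b3; field; rewrite !lt0r_neq0.
split => [r r0|].
  by rewrite PE yE; exact: kolmogorov_dist_tail.
have [r r0 rle] := rate_choice c0 b0.
rewrite EE lee_fin; apply: le_trans rle; rewrite yE.
exact: (mean_kolmogorov_dist_le n0 M0 lip (lexx M) Mpos (lexx _) s2 lsi r0).
Qed.
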